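(* For every dimension $n\ge 3$ and every $N\in\mathbb{N}$ there is a complete unimodular polytopal fan in $\mathbb{R}^n$ with at least $N$ rays which is not a proper refinement of any other unimodular fan; that is, the only complete unimodular fan that it refines is itself.
   Context: A polyhedral cone is the set of nonnegative linear combinations of finitely many vectors. A fan in $\mathbb{R}^n$ is a finite collection of polyhedral cones closed under taking faces and such that any two of its cones intersect in a common face of both. A fan is: complete if the union of its cones is the whole space; rational if the linear span of every cone is a rational subspace; simplicial if every cone is generated by linearly independent vectors; unimodular if it is rational, simplicial, full-dimensional, and the primitive integer generators of the rays of each cone form part of a $\mathbb{Z}$-basis of $\mathbb{Z}^n$. Rays are the one-dimensional cones. For complete fans $\Sigma,\Sigma'$ one says that $\Sigma'$ refines $\Sigma$ if every cone of $\Sigma'$ is contained in some cone of $\Sigma$. The normal fan of a polytope $P$ (convex hull of a finite set of points) consists of the cones $\{\alpha : \langle\alpha,p-q\rangle\ge 0 \text{ for all } p\in F, q\in P\}$ for all nonempty faces $F$ of $P$. A complete fan is polytopal if it is the normal fan of some polytope. *)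

(* Defs.v *)
From HB Require Import structures.
From mathcomp Require Import all_boot all_order all_algebra.
From mathcomp Require Import boolp classical_sets functions cardinality reals.

Set Implicit Arguments.
Unset Strict Implicit.
Unset Printing Implicit Defensive.

Import Order.TTheory GRing.Theory Num.Theory.

Local Open Scope classical_set_scope.
Local Open Scope ring_scope.

Section Cones.
Variables (R : realType) (n : nat).
Local Notation V := 'rV[R]_n.
Implicit Types (u v x y a : V) (s : seq V) (C D P : set V).

Definition dot u v : R := \sum_i u 0 i * v 0 i.

Definition cone s : set V :=
  [set x | exists2 c : 'I_(size s) -> R,
     (forall i, 0 <= c i) & x = \sum_i c i *: s`_i].

Definition polyhedral_cone C : Prop := exists s, C = cone s.

(* The choice a = 0 makes C a face of itself; no cone has an empty face. *)
Definition cone_face C D : Prop :=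
  exists2 a, (forall x, C x -> 0 <= dot a x) &
             D = [set x | C x /\ dot a x = 0].

Definition linspan C : set V :=
  [set x | exists2 s, (forall v, v \in s -> C v) & x \in <<s>>%VS].

Definition has_dim C (d : nat) : Prop :=
  exists2 U : {vspace V}, linspan C = [set` U] & \dim U = d.

Definition conv s : set V :=
  [set x | exists c : 'I_(size s) -> R,
     [/\ forall i, 0 <= c i, \sum_i c i = 1 & x = \sum_i c i *: s`_i]].

Definition polytope P : Prop := exists s, P = conv s.

Definition nonempty_face P D : Prop :=
  D !=set0 /\ exists a, D = [set p | P p /\ forall q, P q -> dot a q <= dot a p].

Definition normal_cone P D : set V :=
  [set a | forall p q, D p -> P q -> 0 <= dot a (p - q)].

Definition normal_fan P : set (set V) :=
  [set C | exists2 D, nonempty_face P D & C = normal_cone P D].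

Definition rational_subspace C : Prop :=
  exists s : seq 'rV[rat]_n,
    C = [set x | x \in <<[seq map_mx (@ratr R) q | q <- s]>>%VS].

Definition primitive (v : 'rV[int]_n) : Prop :=
  \big[gcdn/0%N]_i absz (v 0 i) = 1%N.

Definition real_vec (v : 'rV[int]_n) : V := map_mx (fun z : int => z%:~R) v.

Definition Z_basis (b : seq 'rV[int]_n) : Prop :=
  forall v : 'rV[int]_n,
    exists! c : 'rV[int]_(size b), v = \sum_i c 0 i *: b`_i.

Definition ray_of C D : Prop := cone_face C D /\ has_dim D 1.

Definition primitive_ray_generator C (v : 'rV[int]_n) : Prop :=
  primitive v /\ ray_of C (cone [:: real_vec v]).

End Cones.

Section Fans.
Variables (R : realType) (n : nat).
Implicit Types F G : set (set 'rV[R]_n).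

Definition fan F : Prop :=
  [/\ finite_set F,
      forall C, F C -> polyhedral_cone C,
      forall C D, F C -> cone_face C D -> F D &
      forall C D, F C -> F D -> cone_face C (C `&` D) /\ cone_face D (C `&` D)].

Definition complete F : Prop := \bigcup_(C in F) C = setT.

Definition rational F : Prop := forall C, F C -> rational_subspace (linspan C).

Definition simplicial F : Prop :=
  forall C, F C -> exists2 s : seq 'rV[R]_n, free s & C = cone s.

Definition full_dimensional F : Prop := exists2 C, F C & has_dim C n.

Definition unimodular F : Prop :=
  [/\ rational F, simplicial F, full_dimensional F &
      forall C, F C -> exists2 b : seq 'rV[int]_n, Z_basis b &
        forall v, primitive_ray_generator C v -> v \in b].

Definition rays F : set (set 'rV[R]_n) := [set C | F C /\ has_dim C 1].

Definition polytopal F : Prop :=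
  exists2 P : set 'rV[R]_n, polytope P & F = normal_fan P.

Definition refines F G : Prop := forall C, F C -> exists2 D, G D & C `<=` D.

End Fans.

(* Main.v *)
Require Import Defs.
From mathcomp Require Import all_boot all_order all_algebra.
From mathcomp Require Import boolp classical_sets functions cardinality reals.
From mathcomp Require Import zify ring.

Set Implicit Arguments.
Unset Strict Implicit.
Unset Printing Implicit Defensive.

Import Order.TTheory GRing.Theory Num.Theory.

Local Open Scope classical_set_scope.
Local Open Scope card_scope.
Local Open Scope ring_scope.

(** The fan is that of a projective line bundle over a toric surface with many
rays, multiplied by copies of the projective line; the twist of the bundle
blocks every contraction.

In the plane take the rays (1, k) for 0 <= k <= p, then (0, 1), and the
opposites of all these. Consecutive rays have determinant 1, so they span a
complete, centrally symmetric, unimodular fan. Put its rays in R^n by lifting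
(1, k) to w = (1, k, k^2, 0, ..., 0), (0, 1) to (0, 1, 0, ..., 0), and oppositely
on the other half. The maximal cones of F are spanned by two consecutive lifted
rays and, for each fibre coordinate j, one of e_j and - e_j.

F is a complete unimodular polytopal fan. Integral generators with unit
determinant take care of unimodularity. For the rest the lemmas starting at
[support_facet] need only one vertex for each maximal cone, with two properties:
the support function of the vertices is strictly convex on the given cones, and
every maximal cone has a neighbour across each of its walls. Completeness then
follows by maximising a linear form over the vertices. The vertices come
from a large multiple of a zonogon with the planar fan as normal fan, times a
cube, tilted a little to follow the lift.

F is rigid. Let G be a fan of simplicial cones refined by F, let r be a ray
generator of F, let E be the cone of G with r in its relative interior, and W
its span. Every maximal cone K of F through r lies in a cone of G that has E as
a face; hence if x and y are in K and x + y is in W, then x is in E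
([carrier_absorb]). As E contains no line, this forces E to be a ray:

- r = w_t ([base_ray_carrier]). The cones around w_t contain every fibre vector
  and its opposite, so W meets the fibre U in 0. If W were larger than the line
  of w_t, it would project onto the plane, and then both neighbours of w_t would
  be in W. The planar relation v_prev + v_next = c v_t lifts to a nonzero vector
  of U because the lift bends at t; this vector would be in W.

- r = e_j or r = - e_j ([fibre_ray_carrier]). The cones around r contain all
  w_t. If W contained a vector over a nonzero v of the plane, E would contain
  the point over v of the lifted plane and, by central symmetry, its opposite.

So all rays of F are rays of G, and a simplicial cone of G that contains a
maximal cone of F has to coincide with it ([facet_cone_in]). *)

(** * The dot product *)

Section Dot.
Variables (R : realType) (n : nat).
Implicit Types (u v x y a : 'rV[R]_n).

Lemma dotC u v : dot u v = dot v u.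
Proof. by apply: eq_bigr => i _; rewrite mulrC. Qed.

Lemma dotDr u v w : dot u (v + w) = dot u v + dot u w.
Proof. by rewrite -big_split; apply: eq_bigr => i _; rewrite mxE mulrDr. Qed.

Lemma dotZr u c v : dot u (c *: v) = c * dot u v.
Proof. by rewrite mulr_sumr; apply: eq_bigr => i _; rewrite mxE mulrCA. Qed.

Lemma dotNr u v : dot u (- v) = - dot u v.
Proof. by rewrite -scaleN1r dotZr mulN1r. Qed.

Lemma dotBr u v w : dot u (v - w) = dot u v - dot u w.
Proof. by rewrite dotDr dotNr. Qed.

Lemma dotZl c u v : dot (c *: u) v = c * dot u v.
Proof. by rewrite dotC dotZr dotC. Qed.

Lemma dot0r u : dot u 0 = 0.
Proof. by rewrite -[X in dot _ X](scale0r 0) dotZr mul0r. Qed.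

Lemma dot_sumr (I : Type) (r : seq I) (P : pred I) u (F : I -> 'rV[R]_n) :
  dot u (\sum_(i <- r | P i) F i) = \sum_(i <- r | P i) dot u (F i).
Proof.
by apply: (big_morph (dot u)) => [v w|]; rewrite ?dotDr ?dot0r.
Qed.

Lemma dot_suml (I : Type) (r : seq I) (P : pred I) (F : I -> 'rV[R]_n) u :
  dot (\sum_(i <- r | P i) F i) u = \sum_(i <- r | P i) dot (F i) u.
Proof. by rewrite dotC dot_sumr; apply: eq_bigr => i _; rewrite dotC. Qed.

End Dot.

(** * Cones spanned by finite families *)

Section IndexedCones.
Variables (R : realType) (n : nat) (J : finType).
Implicit Types (P Q A : {set J}) (f : J -> 'rV[R]_n).

Definition span_cone P f : set 'rV[R]_n :=
  [set x | exists2 c : J -> R,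
     (forall j, 0 <= c j) & x = \sum_(j in P) c j *: f j].

Definition indep P f : Prop :=
  forall c : J -> R, \sum_(j in P) c j *: f j = 0 ->
    forall j, j \in P -> c j = 0.

Lemma span_cone_seq P f : span_cone P f = cone [seq f j | j <- enum P].
Proof.
have sz : size [seq f j | j <- enum P] = #|P| by rewrite size_map -cardE.
have nthE (i : 'I_#|P|) : [seq f j | j <- enum P]`_i = f (enum_val i).
  by rewrite (nth_map (enum_default i)) -?cardE.
rewrite /cone sz /=; apply/seteqP; split=> x /= [c c_ge0 ->].
  exists (fun i : 'I_#|P| => c (enum_val i)) => //.
  by rewrite [LHS]big_enum_val; apply: eq_bigr => i _; rewrite nthE.
pose d j := if insub (index j (enum P)) is Some i then c i else 0.
exists d => [j|]; first by rewrite /d; case: insub.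
rewrite [RHS]big_enum_val; apply: eq_bigr => i _; rewrite -nthE /d.
have -> : index (enum_val i) (enum P) = i :> nat.
  by rewrite index_uniq ?enum_uniq -?cardE.
by rewrite valK.
Qed.

Lemma span_coneD P f x y :
  span_cone P f x -> span_cone P f y -> span_cone P f (x + y).
Proof.
move=> [c c0 ->] [d d0 ->]; exists (fun j => c j + d j).
  by move=> j; rewrite addr_ge0.
by rewrite -big_split; apply: eq_bigr => j _; rewrite scalerDl.
Qed.

Lemma span_coneZ P f k x :
  0 <= k -> span_cone P f x -> span_cone P f (k *: x).
Proof.
move=> k0 [c c0 ->]; exists (fun j => k * c j).
  by move=> j; rewrite mulr_ge0.
by rewrite scaler_sumr; apply: eq_bigr => j _; rewrite scalerA.
Qed.

Lemma span_cone0 P f : span_cone P f 0.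
Proof.
by exists (fun=> 0) => //; rewrite big1 // => j _; rewrite scale0r.
Qed.

Lemma span_cone_gen P f j : j \in P -> span_cone P f (f j).
Proof.
move=> Pj; exists (fun k => (k == j)%:R) => [k|]; first exact: ler0n.
rewrite (bigD1 j) //= eqxx scale1r big1 ?addr0 // => k /andP[_ /negPf->].
by rewrite scale0r.
Qed.

Lemma span_cone_sum P f (L : finType) (B : {set L}) (d : L -> R) (g : L -> 'rV[R]_n) :
  (forall l, 0 <= d l) -> (forall l, l \in B -> span_cone P f (g l)) ->
  span_cone P f (\sum_(l in B) d l *: g l).
Proof.
move=> d0 gP; apply: (big_ind (span_cone P f)).
- exact: span_cone0.
- exact: span_coneD.
- by move=> l Bl; apply: span_coneZ; [exact: d0|exact: gP].
Qed.

Lemma span_cone_sub P Q f : P \subset Q -> span_cone P f `<=` span_cone Q f.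
Proof.
move=> PQ x [c c0 ->]; apply: span_cone_sum => // j Pj.
by apply: span_cone_gen; apply: (fintype.subsetP PQ).
Qed.

Lemma indep_sub P Q f : P \subset Q -> indep Q f -> indep P f.
Proof.
move=> PQ indQ c c0 j Pj.
pose d j := if j \in P then c j else 0.
have: d j = 0.
  apply: (indQ d); last exact: (fintype.subsetP PQ _ Pj).
  rewrite (finset.big_setID P) /= (finset.setIidPr PQ) [X in _ + X]big1 ?addr0.
    by rewrite -[RHS]c0; apply: eq_bigr => k Pk; rewrite /d Pk.
  by move=> k; rewrite inE /d => /andP[/negPf-> _]; rewrite scale0r.
by rewrite /d Pj.
Qed.

Lemma indep_coef P f (c d : J -> R) : indep P f ->
  \sum_(j in P) c j *: f j = \sum_(j in P) d j *: f j ->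
  forall j, j \in P -> c j = d j.
Proof.
move=> ind eq_cd j Pj; apply/eqP; rewrite -subr_eq0; apply/eqP.
apply: (ind (fun j => c j - d j)) => //.
under eq_bigr do rewrite scalerBl.
by rewrite sumrB eq_cd subrr.
Qed.

Lemma indep_free P f : indep P f -> free [seq f j | j <- enum P].
Proof.
move=> ind; set s := map _ _.
have sz : size s = #|P| by rewrite size_map -cardE.
have sP : size s == #|P| by apply/eqP.
have nthE (i : 'I_#|P|) : s`_i = f (enum_val i).
  by rewrite (nth_map (enum_default i)) -?cardE.
rewrite -[s]/(val (Tuple sP)); apply/freeP => k k0 i.
pose d j := if insub (index j (enum P)) is Some i then k i else 0.
have dE (l : 'I_#|P|) : d (enum_val l) = k l.
  rewrite /d.
  have -> : index (enum_val l) (enum P) = l :> nat.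
    by rewrite index_uniq ?enum_uniq -?cardE.
  by rewrite valK.
rewrite -dE; apply: ind; last exact: enum_valP.
by rewrite [LHS]big_enum_val -[RHS]k0; apply: eq_bigr => l _; rewrite dE nthE.
Qed.

(** A right inverse of the matrix whose rows are the generators has the dual
basis as its columns. *)
Lemma indep_dual P f : indep P f ->
  exists a : J -> 'rV[R]_n,
    forall j k, j \in P -> k \in P -> dot (a j) (f k) = (j == k)%:R.
Proof.
move=> ind.
pose M := \matrix_(i < #|P|) f (enum_val i).
have rfM : row_free M.
  apply: inj_row_free => v vM0; apply/rowP => i; rewrite [RHS]mxE.
  pose c j := \sum_(k < #|P| | enum_val k == j) v 0 k.
  have cE k : c (enum_val k) = v 0 k.
    by rewrite /c (big_pred1 k) // => l; rewrite (inj_eq enum_val_inj).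
  rewrite -cE; apply: ind; last exact: enum_valP.
  rewrite big_enum_val -[RHS]vM0 mulmx_sum_row; apply: eq_bigr => k _.
  by rewrite cE rowK.
exists (fun j => \row_l \sum_(i < #|P| | enum_val i == j) pinvmx M l i).
move=> j k Pj Pk; rewrite dotC.
have [[i ->] [l ->]] : (exists i : 'I_#|P|, j = enum_val i) /\
    (exists i : 'I_#|P|, k = enum_val i).
  by split; [exists (enum_rank_in Pj j)|exists (enum_rank_in Pj k)];
    rewrite enum_rankK_in.
rewrite (inj_eq enum_val_inj) eq_sym.
transitivity ((M *m pinvmx M) l i); last by rewrite mulmxVp // mxE.
rewrite [RHS]mxE; apply: eq_bigr => h _; congr (_ * _); first by rewrite mxE.
rewrite mxE; apply: big_pred1 => g.
by rewrite (inj_eq enum_val_inj).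
Qed.

(** The sum of the dual vectors of the generators outside Q supports the cone
along the face spanned by Q. *)
Lemma indep_separate P Q f : indep P f -> Q \subset P ->
  exists a, forall j, j \in P -> dot a (f j) = (j \notin Q)%:R.
Proof.
move=> /indep_dual[a aP] QP; exists (\sum_(j in P :\: Q) a j) => j Pj.
rewrite dot_suml; case: (boolP (j \in Q)) => Qj /=.
  rewrite big1 // => k /finset.setDP[Pk Qk]; rewrite aP //.
  by case: eqP => // jk; rewrite jk Qj in Qk.
rewrite (bigD1 j) ?inE ?Pj ?Qj //= aP // eqxx big1 ?addr0 // => k.
by rewrite !inE => /andP[/andP[_ Pk] /negPf kj]; rewrite aP // kj.
Qed.

Lemma span_cone_face P f a : (forall j, j \in P -> 0 <= dot a (f j)) ->
  [set x | span_cone P f x /\ dot a x = 0] =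
  span_cone [set j in P | dot a (f j) == 0] f.
Proof.
move=> a_ge0; apply/seteqP; split=> x /=.
  move=> [[c c0 xE]] ax0; exists c => //.
  rewrite xE (bigID (fun j => dot a (f j) == 0)) /= [X in _ + X]big1 ?addr0.
    by apply: eq_bigl => j; rewrite inE.
  move=> j /andP[Pj aj].
  have: dot a (c j *: f j) = 0.
    move: ax0; rewrite xE dot_sumr => /eqP; rewrite psumr_eq0; last first.
      by move=> k Pk; rewrite dotZr mulr_ge0 ?a_ge0.
    by move=> /allP/(_ j (mem_index_enum j))/implyP/(_ Pj)/eqP.
  by rewrite dotZr => /eqP; rewrite mulf_eq0 (negPf aj) orbF => /eqP->;
    rewrite scale0r.
move=> xQ; split.
  by apply: span_cone_sub xQ; apply/fintype.subsetP => j; rewrite inE => /andP[].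
case: xQ => c c0 ->; rewrite dot_sumr big1 // => j.
by rewrite inE dotZr => /andP[_ /eqP->]; rewrite mulr0.
Qed.

Lemma span_cone_ge0 P f a : (forall j, j \in P -> 0 <= dot a (f j)) ->
  forall x, span_cone P f x -> 0 <= dot a x.
Proof.
move=> a_ge0 x [c c0 ->]; rewrite dot_sumr sumr_ge0 // => j Pj.
by rewrite dotZr mulr_ge0 ?a_ge0.
Qed.

Lemma indep_face P Q f : indep P f -> Q \subset P ->
  cone_face (span_cone P f) (span_cone Q f).
Proof.
move=> ind QP; have [a aP] := indep_separate ind QP.
have a_ge0 j : j \in P -> 0 <= dot a (f j) by move=> Pj; rewrite aP ?ler0n.
exists a; first exact: span_cone_ge0.
rewrite span_cone_face //; congr span_cone; apply/finset.setP => j; rewrite inE.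
case: (boolP (j \in P)) => [Pj|/negP nPj] /=; first by rewrite aP // pnatr_eq0 eqb0 negbK.
by apply/negP => /(fintype.subsetP QP).
Qed.

Lemma face_span_cone P f D : cone_face (span_cone P f) D ->
  exists2 Q : {set J}, Q \subset P & D = span_cone Q f.
Proof.
move=> [a a_ge0 ->]; rewrite span_cone_face.
  by eexists; last reflexivity; apply/fintype.subsetP => j; rewrite inE => /andP[].
by move=> j Pj; apply: a_ge0; apply: span_cone_gen.
Qed.

End IndexedCones.

Section SeqCones.
Variables (R : realType) (n : nat).
Implicit Types s : seq 'rV[R]_n.

Lemma coneE s : cone s = span_cone [set: 'I_(size s)] (fun i => s`_i).
Proof.
apply/seteqP; split=> x /= [c c0 ->]; exists c => //; apply: eq_bigl => i;
  by rewrite inE.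
Qed.

Lemma free_indep s : free s -> indep [set: 'I_(size s)] (fun i => s`_i).
Proof.
rewrite -[s]/(val (in_tuple s)) => /freeP fr c c0 i _; apply: fr; rewrite -[RHS]c0.
by apply: eq_bigl => j; rewrite inE.
Qed.

End SeqCones.

Section Faces.
Variables (R : realType) (n : nat).
Implicit Types (C D E : set 'rV[R]_n).

Lemma face_sub C D : cone_face C D -> D `<=` C.
Proof. by case=> a _ -> x []. Qed.

(** The supporting functional is nonnegative on both summands and vanishes on
their sum. *)
Lemma face_extremal C D x y : cone_face C D -> C x -> C y -> D (x + y) -> D x.
Proof.
move=> [a a_ge0 ->] Cx Cy [_]; rewrite dotDr => /eqP axy; split=> //.
by move: axy; rewrite paddr_eq0 ?a_ge0 // => /andP[/eqP].
Qed.

End Faces.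

(** * Linear spans of cones, and carriers in a simplicial fan *)

Section ConvexCones.
Variables (R : realType) (n : nat).
Implicit Types (C D E : set 'rV[R]_n).

Definition convex_cone E : Prop :=
  (forall x y, E x -> E y -> E (x + y)) /\
  (forall k x, 0 <= k -> E x -> E (k *: x)).

(** The difference set E - E, which is the linear span of a convex cone E. *)
Definition lin_diff E : set 'rV[R]_n := [set x | exists2 y, E y & E (x + y)].

Lemma span_cone_convex (J : finType) (P : {set J}) (f : J -> 'rV[R]_n) :
  convex_cone (span_cone P f).
Proof.
by split=> [x y|k x k_ge0]; [exact: span_coneD|exact: span_coneZ].
Qed.

Lemma cone_convex s : convex_cone (@cone R n s).
Proof. by rewrite coneE; exact: span_cone_convex. Qed.

Lemma diffD E x y : convex_cone E -> lin_diff E x -> lin_diff E y -> lin_diff E (x + y).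
Proof.
move=> [ED _] [u Eu Exu] [v Ev Eyv]; exists (u + v); first exact: ED.
by rewrite addrACA; exact: ED.
Qed.

Lemma diffN E x : lin_diff E x -> lin_diff E (- x).
Proof. by move=> [u Eu Exu]; exists (x + u); rewrite ?addKr. Qed.

Lemma diffZ E k x : convex_cone E -> lin_diff E x -> lin_diff E (k *: x).
Proof.
move=> cE; wlog k_ge0 : k / 0 <= k => [W|] Ex.
  have [/W|/ltW k_le0] := lerP 0 k; first exact.
  rewrite -[k]opprK scaleNr; apply: diffN; apply: W => //.
  by rewrite oppr_ge0.
case: Ex => u Eu Exu; exists (k *: u); first exact: cE.2.
by rewrite -scalerDr; exact: cE.2.
Qed.

Lemma diffB E x y : convex_cone E -> lin_diff E x -> lin_diff E y -> lin_diff E (x - y).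
Proof. by move=> cE Ex Ey; apply: diffD => //; exact: diffN. Qed.

Lemma sub_diff E : convex_cone E -> E `<=` lin_diff E.
Proof. by move=> [ED _] x Ex; exists x => //; exact: ED. Qed.

(** Write x + y as a difference of two elements of E and move the subtracted one
to the other side: extremality of the face applies to the new sum. *)
Lemma face_diff D E x y : convex_cone D -> cone_face D E ->
  D x -> D y -> lin_diff E (x + y) -> E x.
Proof.
move=> [DD _] DE Dx Dy [u Eu Exyu].
apply: (@face_extremal _ _ D E x (y + u)) => //; last by rewrite addrA.
by apply: DD => //; exact: face_sub Eu.
Qed.

Lemma simplicial_pointed s (x : 'rV[R]_n) : free s ->
  cone s x -> cone s (- x) -> x = 0.
Proof.
move=> /free_indep ind; rewrite coneE => -[c c0 xE] [d d0 dE].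
rewrite xE big1 // => j Pj.
suff: c j + d j = 0.
  by move/eqP; rewrite paddr_eq0 // => /andP[/eqP-> _]; rewrite scale0r.
apply: (ind (fun j => c j + d j)) => //.
under eq_bigr do rewrite scalerDl.
by rewrite big_split /= -xE -dE subrr.
Qed.

End ConvexCones.

Section Carriers.
Variables (R : realType) (n : nat) (G : set (set 'rV[R]_n)).
Implicit Types (C D E : set 'rV[R]_n).
Hypotheses (fanG : fan G) (simpG : simplicial G).

(** For a fan G this is the cone with x in its relative interior, described by
its role as the least cone of G that contains x. *)
Definition carrier x E : Prop :=
  [/\ G E, E x & forall D, G D -> D x -> cone_face D E].

(** The intersection with another cone D containing x is a face of the cone; a
functional that supports this face vanishes at x, hence at every generator, so
the face is the whole cone. *)
Lemma relint_carrier (J : finType) (P : {set J}) (f : J -> 'rV[R]_n) c :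
  G (span_cone P f) -> (forall j, j \in P -> 0 < c j) ->
  carrier (\sum_(j in P) c j *: f j) (span_cone P f).
Proof.
set x := \sum_(_ in _) _; set E := span_cone P f => GE c_gt0.
have Ex : E x.
  exists (fun j => if j \in P then c j else 0) => [j|].
    by case: ifP => // /c_gt0/ltW.
  by apply: eq_bigr => j ->.
split=> // D GD Dx; case: fanG => _ _ _ /(_ _ _ GE GD)[[a a_ge0 EDE] DED].
suff EsubD : E `<=` D by rewrite (setIidl EsubD) in DED.
have ax0 : dot a x = 0.
  have: (E `&` D) x by [].
  by rewrite EDE => -[].
have af0 j : j \in P -> dot a (f j) = 0.
  move=> Pj; move/eqP: ax0; rewrite /x dot_sumr psumr_eq0; last first.
    move=> k Pk; rewrite dotZr mulr_ge0 ?(ltW (c_gt0 k Pk)) //.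
    by apply: a_ge0; exact: span_cone_gen.
  move=> /allP/(_ j (mem_index_enum j))/implyP/(_ Pj).
  by rewrite dotZr mulf_eq0 gt_eqF ?c_gt0 //= => /eqP.
move=> y Ey; have: [set z | E z /\ dot a z = 0] y.
  split=> //; case: Ey => d _ ->; rewrite dot_sumr big1 // => j Pj.
  by rewrite dotZr af0 // mulr0.
by rewrite -EDE => -[].
Qed.

Lemma carrier_exists D x : G D -> D x -> exists E, carrier x E.
Proof.
move=> GD Dx; have [s frs DE] := simpG GD.
have ind := free_indep frs.
move: (Dx); rewrite DE coneE => -[c c_ge0 xE].
pose P := [set i | 0 < c i]%SET.
exists (span_cone P (fun i : 'I_(size s) => s`_i)).
have -> : x = \sum_(j in P) c j *: s`_j.
  rewrite xE (finset.big_setID P) /= [X in _ + X]big1 ?addr0.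
    by apply: eq_bigl => i; rewrite !inE.
  move=> i; rewrite !inE andbT -leNgt => ci_le0.
  suff -> : c i = 0 by rewrite scale0r.
  by apply/eqP; rewrite eq_le ci_le0 c_ge0.
apply: relint_carrier => [|i]; last by rewrite inE.
case: fanG => _ _ facesG _; apply: (facesG _ _ GD).
by rewrite DE coneE; apply: indep_face => //; exact: finset.subsetT.
Qed.

End Carriers.

(** * Complete unimodular polytopal fans from integral facets and vertices *)

Section LinearSpans.
Variables (R : realType) (n : nat) (J : finType).
Implicit Types (P : {set J}) (f : J -> 'rV[R]_n).

Lemma linspan_span_cone P f :
  linspan (span_cone P f) = [set` <<[seq f j | j <- enum P]>>%VS].
Proof.
apply/seteqP; split=> x /=.
  move=> [s sP]; apply: subvP; apply/span_subvP => v /sP[c _ ->].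
  apply: memv_suml => j Pj; apply: memvZ; apply: memv_span.
  by apply: map_f; rewrite mem_enum.
move=> xP; exists [seq f j | j <- enum P] => // v /mapP[j].
by rewrite mem_enum => Pj ->; exact: span_cone_gen.
Qed.

Lemma has_dim_span_cone P f : indep P f -> has_dim (span_cone P f) #|P|.
Proof.
move=> ind; exists <<[seq f j | j <- enum P]>>%VS; first exact: linspan_span_cone.
by have /eqP-> := indep_free ind; rewrite size_map -cardE.
Qed.

End LinearSpans.

Section Criterion.
Variables (R : realType) (n : nat) (T I : finType).
Variables (ray : T -> 'rV[int]_n) (gen : I -> 'I_n -> T).
Variables (vert : I -> 'rV[R]_n) (h : T -> R).
Implicit Types (A B : {set T}) (v : 'rV[int]_n) (x : 'rV[R]_n).

Definition rayR t : 'rV[R]_n := real_vec R (ray t).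
(** The labels of the generators of a maximal cone: a facet of the underlying
simplicial complex. *)
Definition facet i : {set T} := [set gen i k | k : 'I_n]%SET.
Definition facet_matrix i : 'M[int]_n := \matrix_k ray (gen i k).
Definition facet_fan : set (set 'rV[R]_n) :=
  [set C | exists i, exists2 A : {set T}, A \subset facet i & C = span_cone A rayR].

Hypothesis facet_unit : forall i, facet_matrix i \in unitmx.

Lemma facet_coordZ i v :
  v = \sum_k (v *m invmx (facet_matrix i)) 0 k *: ray (gen i k).
Proof.
rewrite -[v in LHS](mulmxKV (facet_unit i)) mulmx_sum_row.
by apply: eq_bigr => k _; rewrite rowK.
Qed.

Lemma ray_coordZ i k l :
  (ray (gen i k) *m invmx (facet_matrix i)) 0 l = (k == l)%:R.
Proof.
have -> : ray (gen i k) = row k (facet_matrix i) by rewrite rowK.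
by rewrite -row_mul mulmxV // !mxE.
Qed.

Lemma gen_inj i : injective (gen i).
Proof.
move=> k l eq_kl; have := ray_coordZ i k l.
by rewrite eq_kl ray_coordZ eqxx; case: eqP.
Qed.

Lemma mem_facet i t : reflect (exists k, t = gen i k) (t \in facet i).
Proof.
apply: (iffP imsetP) => [[k _ ->]|[k ->]]; first by exists k.
by exists k.
Qed.

Lemma sum_facet (V : nmodType) i (F : T -> V) :
  \sum_(t in facet i) F t = \sum_k F (gen i k).
Proof.
rewrite big_imset /=; last by move=> k l _ _; exact: gen_inj.
by apply: eq_bigl => k; rewrite inE.
Qed.

Lemma card_facet i : #|facet i| = n.
Proof. by rewrite card_imset ?card_ord //; exact: gen_inj. Qed.

Let coordR i : 'M[R]_n := map_mx intr (invmx (facet_matrix i)).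

Lemma coordRK i : map_mx intr (facet_matrix i) *m coordR i = 1%:M.
Proof. by rewrite -map_mxM mulmxV // map_mx1. Qed.

Lemma ray_coordR i k l : (rayR (gen i k) *m coordR i) 0 l = (k == l)%:R.
Proof. by rewrite -map_mxM mxE ray_coordZ rmorph_nat. Qed.

Lemma facet_indep i : indep (facet i) rayR.
Proof.
move=> c c0 _ /mem_facet[k ->].
have: ((\sum_(t in facet i) c t *: rayR t) *m coordR i) 0 k = 0.
  by rewrite c0 mul0mx mxE.
rewrite sum_facet mulmx_suml summxE (bigD1 k) //= big1 ?addr0.
  by rewrite -scalemxAl mxE ray_coordR eqxx mulr1.
by move=> l /negPf lk; rewrite -scalemxAl mxE ray_coordR lk mulr0.
Qed.

Lemma facet_span i (x : 'rV[R]_n) :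
  exists c : T -> R, x = \sum_(t in facet i) c t *: rayR t.
Proof.
exists (fun t => \sum_(k | gen i k == t) (x *m coordR i) 0 k).
rewrite sum_facet -[x in LHS](mulmx1 x) -(mulmx1C (coordRK i)) mulmxA mulmx_sum_row.
apply: eq_bigr => k _; rewrite (big_pred1 k); last first.
  by move=> l; rewrite (inj_eq (@gen_inj i)).
by congr (_ *: _); rewrite -map_row rowK.
Qed.

Lemma facet_simplicial : simplicial facet_fan.
Proof.
move=> C [i [A Ai ->]]; exists [seq rayR t | t <- enum A].
  by apply: indep_free; exact: indep_sub Ai (@facet_indep i).
exact: span_cone_seq.
Qed.

Lemma facet_rational : Defs.rational facet_fan.
Proof.
move=> C [i [A Ai ->]]; exists [seq map_mx intr (ray t) | t <- enum A].
rewrite linspan_span_cone -map_comp.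
suff /eq_map-> : rayR =1 map_mx ratr \o (fun t => map_mx intr (ray t)) by [].
by move=> t; apply/rowP => j; rewrite !mxE ratr_int.
Qed.

Lemma facet_Z_basis i : Z_basis [seq ray (gen i k) | k <- enum 'I_n].
Proof.
set b := map _ _; have sz : size b = n by rewrite size_map size_enum_ord.
have bE (k : 'I_(size b)) : b`_k = ray (gen i (cast_ord sz k)).
  have kn : (k < n)%N by rewrite -[X in (_ < X)%N]sz.
  rewrite (nth_map (cast_ord sz k)) ?size_enum_ord //.
  by congr (ray (gen i _)); apply: val_inj; rewrite /= nth_enum_ord.
move=> v; exists (\row_k (v *m invmx (facet_matrix i)) 0 (cast_ord sz k)); split.
  rewrite [LHS](facet_coordZ i) (reindex (cast_ord sz)) /=; last first.
    by exists (cast_ord (esym sz)) => k _; rewrite ?cast_ordK ?cast_ordKV.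
  by apply: eq_bigr => k _; rewrite mxE bE.
move=> c vE; apply/rowP => k; rewrite mxE vE mulmx_suml summxE (bigD1 k) //=.
rewrite big1 ?addr0.
  by rewrite bE -scalemxAl mxE ray_coordZ eqxx mulr1.
move=> l /negPf lk; rewrite bE -scalemxAl mxE ray_coordZ.
by rewrite (inj_eq (@cast_ord_inj _ _ _)) lk mulr0.
Qed.

(** A coordinate with respect to an integral basis takes integer values on
integral vectors, so a primitive vector v on the ray of a basis vector is an
integral multiple of it, and the multiple is 1. *)
Lemma primitive_ray_facet i A v : A \subset facet i ->
  primitive_ray_generator (span_cone A rayR) v -> exists2 t, t \in A & v = ray t.
Proof.
move=> Ai [prim_v [/face_span_cone[Q QA vQ] _]].
have v_neq0 : v != 0.
  apply/eqP => v0; move: prim_v; rewrite /primitive big1 // => j _.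
  by rewrite v0 mxE.
have vRE : real_vec R v = map_mx intr v by [].
have coneV (x : 'rV[R]_n) : cone [:: real_vec R v] x -> exists2 a, 0 <= a & x = a *: real_vec R v.
  by move=> [a a_ge0 ->]; exists (a ord0) => //; rewrite big_ord_recl big_ord0 addr0.
have : cone [:: real_vec R v] (real_vec R v).
  by exists (fun=> 1) => //; rewrite big_ord_recl big_ord0 addr0 scale1r.
rewrite vQ => -[c _ vE].
have [t Qt ct] : exists2 t, t \in Q & c t != 0.
  apply/exists_inP; apply: contraNT v_neq0 => /exists_inPn c0.
  have : real_vec R v = 0.
    rewrite vE big1 // => t Qt; move: (c0 t Qt); rewrite negbK => /eqP->.
    by rewrite scale0r.
  move=> /rowP v0; apply/eqP/rowP => j; have := v0 j; rewrite !mxE => /eqP.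
  by rewrite intr_eq0 => /eqP.
have At : t \in A by exact: (fintype.subsetP QA).
exists t => //.
have /mem_facet[k tE] : t \in facet i by exact: (fintype.subsetP Ai).
have : span_cone Q rayR (rayR t) by exact: span_cone_gen.
rewrite -vQ => /coneV[a a_ge0 tv].
pose m := (v *m invmx (facet_matrix i)) 0 k.
have am : a * m%:~R = 1.
  have := ray_coordR i k k; rewrite -tE tv -scalemxAl mxE eqxx vRE -map_mxM mxE.
  exact.
have a_gt0 : 0 < a.
  by rewrite lt_def a_ge0 andbT; apply/eqP => a0; move/eqP: am; rewrite a0 mul0r eq_sym oner_eq0.
have m_gt0 : 0 < m.
  by rewrite -(ltr0z R) -(pmulr_rgt0 _ a_gt0) am ltr01.
have vm : v = m *: ray t.
  apply/rowP => j; rewrite mxE; apply: (@intr_inj R).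
  have := congr1 (fun x : 'rV[R]_n => x 0 j) tv; rewrite rmorphM /= !mxE => ->.
  by rewrite mulrA [_ * a]mulrC am mul1r.
have : (absz m %| 1)%N.
  rewrite -prim_v; apply/dvdn_biggcdP => j _.
  by rewrite vm mxE abszM dvdn_mulr.
rewrite dvdn1 => /eqP m1; rewrite vm -[m]gez0_abs ?(ltW m_gt0) // m1.
by rewrite scale1r.
Qed.

Lemma facet_full_dimensional (i : I) : full_dimensional facet_fan.
Proof.
exists (span_cone (facet i) rayR); first by exists i, (facet i).
by rewrite -[X in has_dim _ X](card_facet i); apply: has_dim_span_cone; exact: (@facet_indep i).
Qed.

Lemma facet_unimodular (i : I) : unimodular facet_fan.
Proof.
split; [exact: facet_rational|exact: facet_simplicial|exact: facet_full_dimensional i|].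
move=> C [j [A Aj ->]]; exists [seq ray (gen j k) | k <- enum 'I_n].
  exact: facet_Z_basis.
move=> v /(primitive_ray_facet Aj)[t At ->].
have /mem_facet[k ->] : t \in facet j by exact: (fintype.subsetP Aj).
by apply: map_f; rewrite mem_enum.
Qed.

Hypothesis support : forall t j, dot (rayR t) (vert j) <= h t ?= iff (t \in facet j).

Lemma support_facet i t : t \in facet i -> dot (rayR t) (vert i) = h t.
Proof. by move=> ti; apply/eqP; rewrite (support t i).2. Qed.

Lemma vert_max i A (c : T -> R) j : A \subset facet i -> (forall t, 0 <= c t) ->
  dot (\sum_(t in A) c t *: rayR t) (vert j) <= dot (\sum_(t in A) c t *: rayR t) (vert i).
Proof.
move=> Ai c_ge0; rewrite !dot_suml ler_sum // => t At; rewrite !dotZl.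
rewrite ler_wpM2l // (@support_facet i) ?(support t j).1 //.
exact: (fintype.subsetP Ai).
Qed.

(** Each generator contributes a nonnegative amount to the loss of value from
[vert i] to [vert j]. If the total loss is 0, each contribution is 0, so a generator
with nonzero coefficient attains its height at [vert j] as well. *)
Lemma vert_max_eq i A (c : T -> R) j : A \subset facet i -> (forall t, 0 <= c t) ->
  dot (\sum_(t in A) c t *: rayR t) (vert j) = dot (\sum_(t in A) c t *: rayR t) (vert i) ->
  forall t, t \in A -> c t != 0 -> t \in facet j.
Proof.
move=> Ai c_ge0 /eqP; rewrite eq_sym -subr_eq0 !dot_suml -sumrB psumr_eq0.
  move=> /allP max_eq t At ct; have := max_eq t (mem_index_enum t).
  rewrite At !dotZl -mulrBr mulf_eq0 (negPf ct) /= subr_eq0.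
  by rewrite (support_facet (fintype.subsetP Ai t At)) eq_sym (support t j).2.
move=> t At; rewrite !dotZl -mulrBr mulr_ge0 // subr_ge0.
by rewrite (support_facet (fintype.subsetP Ai t At)) (support t j).1.
Qed.

(** At a common point the vertices of both facets give the same maximal value, so
the generators that occur with positive coefficients belong to both facets;
uniqueness of coordinates in one facet then compares the two representations. *)
Lemma span_cone_meet i j A B : A \subset facet i -> B \subset facet j ->
  span_cone A rayR `&` span_cone B rayR = span_cone (A :&: B)%SET rayR.
Proof.
move=> Ai Bj; apply/seteqP; split=> x /=; last first.
  move=> xAB; split; apply: span_cone_sub xAB; [exact: finset.subsetIl|exact: finset.subsetIr].
move=> [[c c_ge0 xA] [d d_ge0 xB]].
have eq_ij : dot x (vert j) = dot x (vert i).
  apply/eqP; rewrite eq_le {1 2}xA vert_max //= xB vert_max //.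
have cj t : t \in A -> c t != 0 -> t \in facet j.
  by move: eq_ij; rewrite xA => /(vert_max_eq Ai c_ge0); apply.
pose c' t := if t \in A then c t else 0.
pose d' t := if t \in B then d t else 0.
have eq_cd : forall t, t \in facet j -> c' t = d' t.
  apply: (@indep_coef _ _ _ (facet j) rayR); first exact: (@facet_indep j).
  transitivity x.
    rewrite xA [RHS](bigID (fun t => t \in facet j)) /= [X in _ + X]big1 ?addr0.
      rewrite [LHS](bigID (fun t => t \in A)) /= [X in _ + X]big1 ?addr0.
        by apply: eq_big => [t|t /andP[_ At]]; rewrite 1?andbC // /c' At.
      by move=> t /andP[_ /negPf At]; rewrite /c' At scale0r.
    move=> t /andP[At tj]; have [->|/(cj t At)] := eqVneq (c t) 0.
      by rewrite scale0r.
    by rewrite (negPf tj).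
  rewrite xB [RHS](finset.big_setID B) /= (finset.setIidPr Bj) [X in _ + X]big1 ?addr0.
    by apply: eq_bigr => t Bt; rewrite /d' Bt.
  by move=> t; rewrite inE /d' => /andP[/negPf-> _]; rewrite scale0r.
exists c => //; rewrite xA (finset.big_setID B) /= [X in _ + X]big1 ?addr0 //.
move=> t; rewrite inE => /andP[Bt At]; have [->|ct] := eqVneq (c t) 0.
  by rewrite scale0r.
have := eq_cd t (cj t At ct); rewrite /c' /d' At (negPf Bt) => ->.
by rewrite scale0r.
Qed.

Lemma facet_fan_fan : fan facet_fan.
Proof.
split.
- apply: (@sub_finite_set _ _ ((fun A : {set T} => span_cone A rayR) @` setT)).
    by move=> C [i [A _ ->]]; exists A.
  by apply: finite_image; exact: finite_finset.
- move=> C [i [A _ ->]]; exists [seq rayR t | t <- enum A].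
  exact: span_cone_seq.
- move=> C D [i [A Ai ->]] /face_span_cone[Q QA ->].
  by exists i, Q => //; exact: fintype.subset_trans QA Ai.
- move=> C D [i [A Ai ->]] [j [B Bj ->]]; rewrite (span_cone_meet Ai Bj).
  split; apply: indep_face.
  + exact: indep_sub Ai (@facet_indep i).
  + exact: finset.subsetIl.
  + exact: indep_sub Bj (@facet_indep j).
  + exact: finset.subsetIr.
Qed.

(** Two labels on the same ray would make it the cone of the empty
intersection. *)
Lemma facet_rays (N : nat) (tau : nat -> T) :
  (forall k, exists i, tau k \in facet i) ->
  (forall k l, (k < N)%N -> (l < N)%N -> tau k = tau l -> k = l) ->
  `I_N #<= rays facet_fan.
Proof.
move=> tauF tau_inj; pose f k := span_cone [set tau k]%SET rayR.
have subF i t : t \in facet i -> [set t]%SET \subset facet i by rewrite finset.sub1set.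
have f_inj : {in `I_N &, injective f}.
  move=> k l; rewrite !inE => kN lN eq_kl; apply: tau_inj => //.
  have [[i ki] [j lj]] := (tauF k, tauF l); apply/eqP; apply: contraT => neq_kl.
  have ind : indep [set tau k]%SET rayR by exact: indep_sub (subF _ _ ki) (@facet_indep i).
  have rk : span_cone [set tau k]%SET rayR (rayR (tau k)).
    by apply: span_cone_gen; rewrite finset.in_set1.
  have : (span_cone [set tau k]%SET rayR `&` span_cone [set tau l]%SET rayR) (rayR (tau k)).
    by split=> //; rewrite -[span_cone [set tau l]%SET _]/(f l) -eq_kl.
  rewrite (span_cone_meet (subF _ _ ki) (subF _ _ lj)).
  rewrite (_ : _ :&: _ = finset.set0)%SET; last first.
    by apply/finset.setP => t; rewrite !inE; case: eqP => // ->; rewrite (negPf neq_kl).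
  move=> [c _]; rewrite finset.big_set0 => rk0.
  have /eqP : (1 : R) = 0.
    apply: (ind (fun=> 1)); last by rewrite finset.in_set1.
    by rewrite finset.big_set1 scale1r.
  by rewrite oner_eq0.
rewrite -(card_le_eql (inj_card_eq f_inj)); apply: subset_card_le.
move=> _ [k _ <-]; have [i ki] := tauF k; split; first by exists i, [set tau k]%SET; rewrite ?subF.
have := has_dim_span_cone (indep_sub (subF _ _ ki) (@facet_indep i)).
by rewrite finset.cards1.
Qed.

Hypothesis flip : forall i t, t \in facet i ->
  exists2 j, t \notin facet j & facet i :\ t \subset facet j.

(** The two vertices span an edge of the polytope, along which the generators
other than t are constant. So the value of a linear form at them differs by a
positive multiple of its t-coordinate. *)
Lemma flip_dot i t (c : T -> R) : t \in facet i ->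
  exists j, [/\ t \notin facet j, facet i :\ t \subset facet j &
    exists2 k, 0 < k &
      dot (\sum_(u in facet i) c u *: rayR u) (vert i - vert j) = c t * k].
Proof.
move=> ti; have [j tj ij] := flip ti; exists j; split=> //.
exists (h t - dot (rayR t) (vert j)).
  by rewrite subr_gt0 lt_neqAle (support t j).2 tj (support t j).1.
rewrite dot_suml (bigD1 t) //= big1 ?addr0 => [|u /andP[ui ut]].
  by rewrite dotZl dotBr (support_facet ti).
rewrite dotZl dotBr (support_facet ui) (@support_facet j) ?subrr ?mulr0 //.
by apply: (fintype.subsetP ij); rewrite !inE ut.
Qed.

Lemma coef_ge0_of_max i (c : T -> R) :
  (forall j, dot (\sum_(u in facet i) c u *: rayR u) (vert j) <=
             dot (\sum_(u in facet i) c u *: rayR u) (vert i)) ->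
  forall t, t \in facet i -> 0 <= c t.
Proof.
move=> x_max t ti; have [j [_ _ [k k_gt0 xk]]] := flip_dot c ti.
by rewrite -(pmulr_lge0 _ k_gt0) -xk dotBr subr_ge0.
Qed.

(** At a vertex where the linear form x is maximal, all coordinates of x are
nonnegative: otherwise some neighbouring vertex would be better. *)
Lemma in_facet_cone (i0 : I) x : exists i, span_cone (facet i) rayR x.
Proof.
pose i := [arg max_(i > i0) dot x (vert i)]%O.
have x_max j : dot x (vert j) <= dot x (vert i).
  by rewrite /i; case: arg_maxP => // k _; apply.
have [c xE] := facet_span i x.
have c_ge0 : forall t, t \in facet i -> 0 <= c t.
  by apply: coef_ge0_of_max; rewrite -xE.
exists i, (fun t => if t \in facet i then c t else 0) => [t|].
  by case: ifP => // /c_ge0.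
by rewrite {1}xE; apply: eq_bigr => t ->.
Qed.

Lemma facet_complete (i0 : I) : complete facet_fan.
Proof.
apply/seteqP; split=> // x _; have [i xi] := in_facet_cone i0 x.
by exists (span_cone (facet i) rayR) => //; exists i, (facet i).
Qed.

Definition vert_polytope : set 'rV[R]_n := conv [seq vert i | i <- enum I].

Lemma vert_polytopeP x : vert_polytope x <->
  exists c : I -> R, [/\ forall i, 0 <= c i, \sum_i c i = 1 & x = \sum_i c i *: vert i].
Proof.
have sz : size [seq vert i | i <- enum I] = #|I| by rewrite size_map -cardE.
have nthE (k : 'I_#|I|) : [seq vert i | i <- enum I]`_k = vert (enum_val k).
  by rewrite (nth_map (enum_default k)) -?cardE.
rewrite /vert_polytope /conv sz /=; split=> -[c [c_ge0 c_sum ->]].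
  exists (fun i => c (enum_rank i)); split=> //.
    by rewrite -[RHS]c_sum [LHS]big_enum_val; apply: eq_bigr => k _; rewrite enum_valK.
  by rewrite [RHS]big_enum_val; apply: eq_bigr => k _; rewrite enum_valK nthE.
exists (fun k => c (enum_val k)); split=> //.
  by rewrite -[RHS]c_sum [RHS]big_enum_val.
by rewrite [LHS]big_enum_val; apply: eq_bigr => k _; rewrite nthE.
Qed.

Lemma vert_in_polytope i : vert_polytope (vert i).
Proof.
apply/vert_polytopeP; exists (fun j => (j == i)%:R); split=> [j||].
- exact: ler0n.
- by rewrite (bigD1 i) //= eqxx big1 ?addr0 // => j /negPf->.
- rewrite (bigD1 i) //= eqxx scale1r big1 ?addr0 // => j /negPf->.
  by rewrite scale0r.
Qed.

Lemma polytope_le x a b : (forall i, dot a (vert i) <= b) ->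
  vert_polytope x -> dot a x <= b.
Proof.
move=> ab /vert_polytopeP[c [c_ge0 c_sum ->]].
rewrite dot_sumr -[b]mul1r -c_sum mulr_suml ler_sum // => i _.
by rewrite dotZr ler_wpM2l.
Qed.

(** The generators in A are exactly the facet coordinates of a that are nonzero.
A vertex reached by flipping out a generator outside A stays on the face where a
is maximal. A form b in the normal cone is maximal there too, and at the
vertex i, so its coordinate on this generator is both nonpositive and
nonnegative. *)
Lemma normal_cone_facet i A (c : T -> R) : A \subset facet i ->
  (forall t, 0 <= c t) -> (forall t, t \in A -> c t != 0) ->
  let a := \sum_(t in A) c t *: rayR t in
  normal_cone vert_polytope
    [set p | vert_polytope p /\ forall q, vert_polytope q -> dot a q <= dot a p] =
  span_cone A rayR.
Proof.
move=> Ai c_ge0 c_neq0 a.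
have tiA t : t \in A -> t \in facet i by exact: (fintype.subsetP Ai).
have a_max x : vert_polytope x -> dot a x <= dot a (vert i).
  by apply: polytope_le => j; exact: vert_max.
have rayP t x : vert_polytope x -> dot (rayR t) x <= h t.
  by apply: polytope_le => j; exact: (support t j).1.
have face_vert j : A \subset facet j -> dot a (vert j) = dot a (vert i).
  move=> Aj; rewrite /a !dot_suml; apply: eq_bigr => t At; rewrite !dotZl.
  by rewrite !support_facet ?(fintype.subsetP Aj) ?tiA.
apply/seteqP; split=> b /=.
  move=> bN; have [d bE] := facet_span i b.
  have bi j : dot b (vert j) <= dot b (vert i).
    rewrite -subr_ge0 -dotBr; apply: bN (vert_in_polytope j).
    by split; [exact: vert_in_polytope|exact: a_max].
  have d_ge0 : forall t, t \in facet i -> 0 <= d t.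
    by apply: coef_ge0_of_max; rewrite -bE.
  have d_eq0 t : t \in facet i -> t \notin A -> d t = 0.
    move=> ti tA; have [j [tj ij [k k_gt0]]] := flip_dot d ti.
    rewrite -bE dotBr => bk; apply/eqP; rewrite eq_le d_ge0 // andbT.
    rewrite -(pmulr_lle0 _ k_gt0) -bk subr_le0 -subr_ge0 -dotBr.
    apply: bN (vert_in_polytope i); split; first exact: vert_in_polytope.
    move=> q /a_max; rewrite face_vert //; apply/fintype.subsetP => u Au.
    apply: (fintype.subsetP ij); rewrite !inE tiA // andbT.
    by apply: contraNneq tA => <-.
  exists (fun t => if t \in A then d t else 0) => [t|].
    by case: ifP => // /tiA/d_ge0.
  rewrite bE (finset.big_setID A) /= (finset.setIidPr Ai) [X in _ + X]big1 ?addr0.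
    by apply: eq_bigr => t ->.
  by move=> t /finset.setDP[ti tA]; rewrite d_eq0 // scale0r.
move=> [d d_ge0 ->] p q [pP p_max] qP; rewrite dot_suml sumr_ge0 // => t At.
rewrite dotZl mulr_ge0 // dotBr subr_ge0.
suff -> : dot (rayR t) p = h t by exact: rayP.
have : dot a (vert i - p) = 0.
  apply/eqP; rewrite dotBr subr_eq0 eq_le a_max // andbT.
  by rewrite p_max //; exact: vert_in_polytope.
move/eqP; rewrite /a dot_suml psumr_eq0 => [|u Au].
  move=> /allP/(_ t (mem_index_enum t))/implyP/(_ At).
  rewrite dotZl mulf_eq0 (negPf (c_neq0 t At)) /= dotBr (support_facet (tiA t At)).
  by rewrite subr_eq0 => /eqP.
by rewrite dotZl mulr_ge0 // dotBr (support_facet (tiA u Au)) subr_ge0 rayP.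
Qed.

Lemma facet_polytopal (i0 : I) : polytopal facet_fan.
Proof.
exists vert_polytope; first by eexists; reflexivity.
apply/seteqP; split=> C.
  move=> [i [A Ai ->]]; have := @normal_cone_facet i A (fun=> 1) Ai.
  move=> /(_ (fun=> ler01) (fun _ _ => oner_neq0 _)) <-.
  eexists; last reflexivity; split; last by eexists; reflexivity.
  exists (vert i); split; first exact: vert_in_polytope.
  by move=> q; apply: polytope_le => j; exact: vert_max.
move=> [D [_ [a ->]] ->]; have [i [c c_ge0 aE]] := in_facet_cone i0 a.
pose A := [set t in facet i | c t != 0]%SET.
have Ai : A \subset facet i by apply/fintype.subsetP => t; rewrite inE => /andP[].
have {}aE : a = \sum_(t in A) c t *: rayR t.
  rewrite aE (finset.big_setID A) /= (finset.setIidPr Ai) [X in _ + X]big1 ?addr0 //.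
  by move=> t; rewrite !inE => /andP[+ ti]; rewrite ti negbK => /eqP->; rewrite scale0r.
exists i, A => //; rewrite aE; apply: (@normal_cone_facet i) => // t.
by rewrite inE => /andP[].
Qed.

End Criterion.

(** * Coarsenings that keep all rays *)

Section Rigidity.
Variables (R : realType) (n : nat) (T I : finType).
Variables (ray : T -> 'rV[int]_n) (gen : I -> 'I_n -> T).
Variable (G : set (set 'rV[R]_n)).
Hypothesis facet_unit : forall i, facet_matrix ray gen i \in unitmx.
Hypotheses (fanG : fan G) (simpG : simplicial G).
Hypothesis refG : refines (facet_fan ray gen) G.

Local Notation r := (rayR R ray).
Local Notation facet := (facet gen).

Lemma facet_cone_sub i : exists2 D, G D & span_cone (facet i) r `<=` D.
Proof. by apply: refG; exists i, (facet i). Qed.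

Lemma simplicial_convex D : G D -> convex_cone D.
Proof. by move=> /simpG[s _ ->]; exact: cone_convex. Qed.

Lemma carrier_convex x E : carrier G x E -> convex_cone E.
Proof. by case=> GE _ _; exact: simplicial_convex. Qed.

Lemma carrier_pointed x E y : carrier G x E -> E y -> E (- y) -> y = 0.
Proof. by case=> /simpG[s frs ->] _ _; exact: simplicial_pointed. Qed.

Lemma ray_carrier_exists i t : t \in facet i -> exists E, carrier G (r t) E.
Proof.
move=> ti; have [D GD KD] := facet_cone_sub i.
by apply: carrier_exists GD _ => //; apply: KD; exact: span_cone_gen.
Qed.

(** The facet cone lies in a cone of G which contains the ray, hence has the
carrier E as a face. This holds for all facet cones through the ray, with the
same E; playing them off against each other is what restricts E. *)
Lemma carrier_absorb i t E x y : t \in facet i -> carrier G (r t) E ->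
  span_cone (facet i) r x -> span_cone (facet i) r y -> lin_diff E (x + y) -> E x.
Proof.
move=> ti [GE Et minE] Kx Ky; have [D GD KD] := facet_cone_sub i.
apply: (@face_diff _ _ D); first exact: simplicial_convex.
- by apply: minE => //; apply: KD; exact: span_cone_gen.
- exact: KD.
- exact: KD.
Qed.

Lemma carrier_absorb1 i t E x : t \in facet i -> carrier G (r t) E ->
  span_cone (facet i) r x -> lin_diff E x -> E x.
Proof.
move=> ti carE Kx Ex; apply: (carrier_absorb ti carE Kx (span_cone0 _ _)).
by rewrite addr0.
Qed.

Hypothesis cover : forall x, exists i, span_cone (facet i) r x.
Hypothesis ray_rays : forall i t E x, t \in facet i -> carrier G (r t) E ->
  E x -> exists k, x = k *: r t.

(** The rays of the facet cone are extremal in the simplicial cone D of G that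
contains it. As they span the space, every generator of D occurs in one of them
with a nonzero coefficient, and by extremality it lies on that ray. *)
Lemma facet_cone_in i : G (span_cone (facet i) r).
Proof.
have [D GD KD] := facet_cone_sub i.
suff DK : D `<=` span_cone (facet i) r by rewrite (_ : span_cone _ _ = D) //; apply/seteqP.
have [s frs DE] := simpG GD; have ind := free_indep frs.
have [a aP] := indep_dual ind.
have {}aP (l k : 'I_(size s)) : dot (a l) s`_k = (l == k)%:R by apply: aP.
move=> x; rewrite DE coneE => -[c c_ge0 ->].
apply: span_cone_sum => // l _; have [d slE] := @facet_span R _ _ _ _ _ facet_unit i s`_l.
have [t ti atl] : exists2 t, t \in facet i & dot (a l) (r t) != 0.
  apply/exists_inP; apply: contraT => /exists_inPn a0.
  have := aP l l; rewrite slE dot_sumr big1 => [/eqP|t ti].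
    by rewrite eqxx eq_sym oner_eq0.
  by rewrite dotZr; move: (a0 t ti); rewrite negbK => /eqP->; rewrite mulr0.
have rtD : D (r t) by apply: KD; exact: span_cone_gen.
have [E carE] := ray_carrier_exists ti.
have DfE : cone_face D E by case: carE => _ _; apply.
move: (rtD); rewrite DE coneE => -[e e_ge0 rtE].
have el : dot (a l) (r t) = e l.
  rewrite rtE dot_sumr (bigD1 l) ?finset.in_setT //= dotZr aP eqxx mulr1 big1 ?addr0 //.
  by move=> k /andP[_ /negPf kl]; rewrite dotZr aP eq_sym kl mulr0.
have el_gt0 : 0 < e l by rewrite lt_def e_ge0 -el atl.
have Esl : E (e l *: s`_l).
  have sD (k : 'I_(size s)) : D s`_k.
    by rewrite DE coneE; exact: (span_cone_gen (fun i : 'I_(size s) => s`_i)).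
  have cD := simplicial_convex GD.
  apply: (face_extremal (y := \sum_(k | k != l) e k *: s`_k) DfE).
  - exact: cD.2.
  - rewrite DE coneE; apply: (big_ind (span_cone _ _)) => [|u v|k _].
    + exact: span_cone0.
    + exact: span_coneD.
    + by apply: span_coneZ => //; exact: (span_cone_gen (fun i : 'I_(size s) => s`_i)).
  - case: carE => _ + _; rewrite rtE (bigD1 l) ?finset.in_setT //=.
    by rewrite (eq_bigl (fun k => k != l)) // => k; rewrite inE.
have [k skE] := ray_rays ti carE Esl.
have : e l = k * e l.
  by have := congr1 (dot (a l)) skE; rewrite !dotZr aP eqxx el mulr1.
have -> : s`_l = (e l)^-1 *: (e l *: s`_l) by rewrite scalerA mulVf ?gt_eqF ?scale1r.
rewrite skE scalerA => k1.
apply: span_coneZ; last exact: span_cone_gen.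
by rewrite mulr_ge0 ?invr_ge0 // -(pmulr_lge0 _ el_gt0) -k1.
Qed.

Theorem coarsening_eq : G = facet_fan ray gen.
Proof.
case: (fanG) => _ _ facesG _; apply/seteqP; split=> C.
  move=> GC; have [s frs CE] := simpG GC; rewrite coneE in CE.
  have GC' := GC; rewrite CE in GC'.
  have [_ _ minC] := relint_carrier fanG GC' (c := fun=> 1) (fun _ _ => ltr01).
  have [i xi] := cover (\sum_(j in [set: 'I_(size s)]%SET) 1 *: s`_j).
  have [Q Qi CQ] := face_span_cone (minC _ (facet_cone_in i) xi).
  by rewrite CE CQ; exists i, Q.
move=> [i [A Ai ->]]; apply: (facesG _ _ (facet_cone_in i)).
by apply: indep_face => //; exact: (@facet_indep _ _ _ _ _ _ facet_unit i).
Qed.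

End Rigidity.

(** * Bundles over a centrally symmetric polygon *)

Lemma sum_ord2 (V : nmodType) (F : 'I_2 -> V) : \sum_k F k = F ord0 + F ord_max.
Proof.
rewrite !big_ord_recl big_ord0 addr0; congr (_ + F _).
exact: val_inj.
Qed.

Section BlockVectors.
Variables (A : Type) (m : nat).
Implicit Types (x : 'rV[A]_(2 + m)).

(** Two coordinates of the base plane, followed by the m coordinates of the
fibre. *)
Definition crd0 x : A := x 0 (lshift m ord0).
Definition crd1 x : A := x 0 (lshift m ord_max).
Definition crdf j x : A := x 0 (rshift 2 j).

Definition vec (a b : A) (c : 'I_m -> A) : 'rV[A]_(2 + m) :=
  row_mx (\row_j if j == ord0 then a else b) (\row_j c j).

Lemma crd0_vec a b c : crd0 (vec a b c) = a.
Proof. by rewrite /crd0 row_mxEl mxE. Qed.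

Lemma crd1_vec a b c : crd1 (vec a b c) = b.
Proof. by rewrite /crd1 row_mxEl mxE. Qed.

Lemma crdf_vec j a b c : crdf j (vec a b c) = c j.
Proof. by rewrite /crdf row_mxEr mxE. Qed.

Lemma ord2P (k : 'I_2) : k = ord0 \/ k = ord_max.
Proof. by case: k => -[|[|//]] lt2; [left|right]; apply: val_inj. Qed.

Lemma vecP x y : crd0 x = crd0 y -> crd1 x = crd1 y ->
  (forall j, crdf j x = crdf j y) -> x = y.
Proof.
move=> e0 e1 ef; apply/rowP => k; rewrite -(fintype.splitK k).
case: (fintype.split k) => [l|j] /=; last exact: ef.
by case: (ord2P l) => ->.
Qed.

End BlockVectors.

Section BlockDot.
Variables (R : realType) (m : nat).
Implicit Types (x y : 'rV[R]_(2 + m)).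

Lemma dotE x y :
  dot x y = crd0 x * crd0 y + crd1 x * crd1 y + \sum_j crdf j x * crdf j y.
Proof.
by rewrite /dot big_split_ord /= sum_ord2.
Qed.

Lemma crd0D x y : crd0 (x + y) = crd0 x + crd0 y. Proof. exact: mxE. Qed.
Lemma crd1D x y : crd1 (x + y) = crd1 x + crd1 y. Proof. exact: mxE. Qed.
Lemma crdfD j x y : crdf j (x + y) = crdf j x + crdf j y. Proof. exact: mxE. Qed.
Lemma crd0N x : crd0 (- x) = - crd0 x. Proof. exact: mxE. Qed.
Lemma crd1N x : crd1 (- x) = - crd1 x. Proof. exact: mxE. Qed.
Lemma crdfN j x : crdf j (- x) = - crdf j x. Proof. exact: mxE. Qed.
Lemma crd0Z k x : crd0 (k *: x) = k * crd0 x. Proof. exact: mxE. Qed.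
Lemma crd1Z k x : crd1 (k *: x) = k * crd1 x. Proof. exact: mxE. Qed.
Lemma crdfZ j k x : crdf j (k *: x) = k * crdf j x. Proof. exact: mxE. Qed.
Lemma crd00 : crd0 (0 : 'rV[R]_(2 + m)) = 0. Proof. exact: mxE. Qed.
Lemma crd10 : crd1 (0 : 'rV[R]_(2 + m)) = 0. Proof. exact: mxE. Qed.
Lemma crdf0 j : crdf j (0 : 'rV[R]_(2 + m)) = 0. Proof. exact: mxE. Qed.

Definition crdE := (crd0D, crd1D, crdfD, crd0N, crd1N, crdfN, crd0Z, crd1Z, crdfZ,
  crd00, crd10, crdf0, crd0_vec, crd1_vec, crdf_vec).

End BlockDot.

(** A centrally symmetric, complete, unimodular planar fan with rays
v_t = (lp_x t, lp_y t) in cyclic order, as the normal fan of the polygon whose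
vertex (lp_vx t, lp_vy t) belongs to the cone of v_t and its successor. The two
unit determinants around t give v_prev + v_next = det(v_prev, v_next) v_t;
[lp_bend] says that the lift violates this relation at every t, that is, the
piecewise linear function with values [lp_lift] has a genuine kink along every
ray. *)
Record lifted_polygon (B : finType) := LiftedPolygon {
  lp_x : B -> int;
  lp_y : B -> int;
  lp_lift : B -> int;
  lp_next : B -> B;
  lp_prev : B -> B;
  lp_opp : B -> B;
  lp_vx : B -> int;
  lp_vy : B -> int;
  lp_height : B -> int;
  lp_prevK : cancel lp_prev lp_next;
  lp_det_next : forall t, lp_x t * lp_y (lp_next t) - lp_x (lp_next t) * lp_y t = 1;
  lp_opp_next : forall t, lp_opp (lp_next t) = lp_next (lp_opp t);
  lp_x_opp : forall t, lp_x (lp_opp t) = - lp_x t;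
  lp_y_opp : forall t, lp_y (lp_opp t) = - lp_y t;
  lp_lift_opp : forall t, lp_lift (lp_opp t) = - lp_lift t;
  lp_bend : forall t, lp_lift (lp_prev t) + lp_lift (lp_next t) !=
    (lp_x (lp_prev t) * lp_y (lp_next t) - lp_x (lp_next t) * lp_y (lp_prev t)) * lp_lift t;
  lp_support : forall u t,
    lp_x u * lp_vx t + lp_y u * lp_vy t <= lp_height u ?= iff (u == t) || (u == lp_next t)
}.

Section Bundle.
Variables (R : realType) (B : finType) (m' : nat) (L : lifted_polygon B).
Local Notation m := m'.+1.
Local Notation X := (lp_x L).
Local Notation Y := (lp_y L).
Local Notation H := (lp_lift L).
Local Notation nx := (lp_next L).
Local Notation pv := (lp_prev L).
Local Notation opp := (lp_opp L).
Local Notation qx := (lp_vx L).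
Local Notation qy := (lp_vy L).
Local Notation h0 := (lp_height L).
Local Notation det s t := (X s * Y t - X t * Y s).
Local Notation det_nx := (lp_det_next L).
Local Notation pvK := (lp_prevK L).

Local Notation T := (B + bool * 'I_m)%type.
Local Notation I := (B * {ffun 'I_m -> bool})%type.

Definition sg (b : bool) : int := (-1) ^+ b.

Definition bundle_ray (t : T) : 'rV[int]_(2 + m) :=
  match t with
  | inl u => vec (X u) (Y u) (fun j => if j == ord0 then H u else 0)
  | inr (b, j) => vec 0 0 (fun k => if k == j then sg b else 0)
  end.

Definition bundle_gen (i : I) (k : 'I_(2 + m)) : T :=
  match fintype.split k with
  | inl l => inl (if l == ord0 then i.1 else nx i.1)
  | inr j => inr (i.2 j, j)
  end.

Local Notation facet := (facet bundle_gen).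
Local Notation r := (rayR R bundle_ray).

Lemma mem_facet_inl i u : (inl u \in facet i) = (u == i.1) || (u == nx i.1).
Proof.
apply/mem_facet/orP => [[k]|].
  rewrite /bundle_gen; case: fintype.split => // l [->].
  by case: ifP => _; [left|right].
case=> /eqP->; [exists (lshift m ord0)|exists (lshift m ord_max)];
  by rewrite /bundle_gen -[lshift _ _]/(unsplit (inl _)) unsplitK.
Qed.

Lemma mem_facet_inr i b j : (inr (b, j) \in facet i) = (b == i.2 j).
Proof.
apply/mem_facet/eqP => [[k]|->].
  by rewrite /bundle_gen; case: fintype.split => // l [-> ->].
by exists (rshift 2 j); rewrite /bundle_gen -[rshift _ _]/(unsplit (inr _)) unsplitK.
Qed.

Lemma bundle_unit i : facet_matrix bundle_ray bundle_gen i \in unitmx.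
Proof.
case: i => t e.
pose D2 : 'M[int]_2 := \matrix_(k, l) if k == ord0 then (if l == ord0 then X t else Y t)
                      else (if l == ord0 then X (nx t) else Y (nx t)).
have D2E : \det D2 = 1.
  rewrite (expand_det_row _ ord0) !big_ord_recl big_ord0 addr0 /cofactor !det_mx11.
  rewrite !mxE /= -[RHS](det_nx t); ring.
have -> : facet_matrix bundle_ray bundle_gen (t, e) =
   block_mx D2 (\matrix_(k, j) if j == ord0 then (if k == ord0 then H t else H (nx t)) else 0)
     0 (diag_mx (\row_j sg (e j))).
  apply/matrixP => k l; rewrite mxE -[k]fintype.splitK -[l]fintype.splitK /bundle_gen unsplitK.
  case: (fintype.split k) => k'; case: (fintype.split l) => l' /=.
  - rewrite block_mxEul row_mxEl !mxE; by case: (k' == ord0).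
  - rewrite block_mxEur row_mxEr !mxE; by case: (k' == ord0).
  - by rewrite block_mxEdl row_mxEl !mxE; case: ifP.
  - rewrite block_mxEdr row_mxEr !mxE eq_sym; by case: eqP => [->|].
rewrite unitmxE det_ublock D2E mul1r det_diag unitr_prod // => j _.
by rewrite mxE unitrX // unitrN unitr1.
Qed.

Lemma nx_neq t : nx t != t.
Proof.
by apply/eqP => nxt; have := (det_nx t); rewrite nxt subrr => /eqP; rewrite eq_sym oner_eq0.
Qed.

Lemma nx_nx_neq t : nx (nx t) != t.
Proof.
apply/eqP => nxt; have := (det_nx (nx t)); rewrite nxt => d1.
have : det t (nx t) + det (nx t) t = 2 by rewrite det_nx d1.
suff -> : det t (nx t) + det (nx t) t = 0 by [].
ring.
Qed.

Lemma bundle_flip i t : t \in facet i ->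
  exists2 j, t \notin facet j & facet i :\ t \subset facet j.
Proof.
have sub_in (t' : T) j : (forall u, inl u \in facet i -> inl u != t' -> inl u \in facet j) ->
    (forall b k, inr (b, k) \in facet i -> inr (b, k) != t' -> inr (b, k) \in facet j) ->
    facet i :\ t' \subset facet j.
  move=> Hl Hr; apply/fintype.subsetP => -[u|[b k]]; rewrite !inE => /andP[ut ui];
    [exact: Hl|exact: Hr].
case: t => [u|[b j]].
  rewrite mem_facet_inl => /orP[]/eqP->.
    exists (nx i.1, i.2).
      by rewrite mem_facet_inl /= negb_or eq_sym nx_neq eq_sym nx_nx_neq.
    apply: sub_in => [v|b k]; last by rewrite !mem_facet_inr.
    by rewrite !mem_facet_inl => /orP[/eqP->|->//]; rewrite eqxx.
  exists (pv i.1, i.2).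
    rewrite mem_facet_inl /= negb_or pvK nx_neq andbT.
    by rewrite -{1}[i.1]pvK nx_nx_neq.
  apply: sub_in => [v|b k]; last by rewrite !mem_facet_inr.
  by rewrite !mem_facet_inl /= pvK => /orP[->|/eqP->]; rewrite ?orbT ?eqxx.
rewrite mem_facet_inr => /eqP bE.
exists (i.1, [ffun k => if k == j then ~~ b else i.2 k]).
  by rewrite mem_facet_inr ffunE eqxx; case: b {bE}.
apply: sub_in => [v|c k]; rewrite ?mem_facet_inl ?mem_facet_inr //= ffunE.
by move=> /eqP->; have [->|//] := eqVneq k j; rewrite bE eqxx.
Qed.

(** (tilt_x t, tilt_y t) is the planar linear form that agrees with the lift on
the cone of t and nx t, obtained by Cramer's rule with determinant 1. *)
Definition tilt_x t : int := H t * Y (nx t) - H (nx t) * Y t.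
Definition tilt_y t : int := H (nx t) * X t - H t * X (nx t).

Lemma tilt_facet u t : (u == t) || (u == nx t) -> X u * tilt_x t + Y u * tilt_y t = H u.
Proof.
move=> ut; have d1 := det_nx t.
have: X u * tilt_x t + Y u * tilt_y t = det t (nx t) * H u.
  by move: ut => /orP[]/eqP->; rewrite /tilt_x /tilt_y; ring.
by rewrite d1 mul1r.
Qed.

(** Slacks of the polygon are integers, so a factor that exceeds all deviations
of the lift from its linear pieces keeps the tilted support function strictly
convex. *)
Definition stretch : int :=
  1 + \sum_(ut : B * B) `|H ut.1 - (X ut.1 * tilt_x ut.2 + Y ut.1 * tilt_y ut.2)|.

Lemma tilt_lt_stretch u t : `|H u - (X u * tilt_x t + Y u * tilt_y t)| < stretch.
Proof.
rewrite /stretch (bigD1 (u, t)) //= addrCA ltrDl ltr_pwDl //.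
exact: sumr_ge0.
Qed.

(** The tilt in the base has to cancel the contribution of the lift, which lives
in fibre coordinate 0, to the value of the two lifted rays of the facet. *)
Definition bundle_vert (i : I) : 'rV[R]_(2 + m) :=
  vec (stretch * qx i.1 - sg (i.2 ord0) * tilt_x i.1)%:~R
      (stretch * qy i.1 - sg (i.2 ord0) * tilt_y i.1)%:~R
      (fun j => (sg (i.2 j))%:~R).

Definition bundle_height (t : T) : R :=
  match t with inl u => (stretch * h0 u)%:~R | inr _ => 1 end.

Lemma rayE t : [/\ crd0 (r t) = (crd0 (bundle_ray t))%:~R, crd1 (r t) = (crd1 (bundle_ray t))%:~R &
  forall j, crdf j (r t) = (crdf j (bundle_ray t))%:~R].
Proof. by split=> [||j]; exact: mxE. Qed.

Lemma ray_inl u : r (inl u) = vec (X u)%:~R (Y u)%:~R (fun j => if j == ord0 then (H u)%:~R else 0).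
Proof.
have [r0 r1 rf] := rayE (inl u).
apply: vecP => [||j]; rewrite ?r0 ?r1 ?rf !crdE //.
by case: ifP.
Qed.

Lemma ray_inr b j : r (inr (b, j)) = vec 0 0 (fun k => if k == j then (sg b)%:~R else 0).
Proof.
have [r0 r1 rf] := rayE (inr (b, j)).
apply: vecP => [||k]; rewrite ?r0 ?r1 ?rf !crdE //.
by case: ifP.
Qed.

Lemma sg_mul b c : sg b * sg c = if b == c then 1 else -1.
Proof. by case: b; case: c. Qed.

Lemma bundle_support t i : dot (r t) (bundle_vert i) <= bundle_height t ?= iff (t \in facet i).
Proof.
case: t => [u|[b j]].
  rewrite mem_facet_inl ray_inl dotE !crdE (bigD1 ord0) //= !crdE eqxx.
  rewrite big1 ?addr0 => [|k /negPf k0]; last by rewrite !crdE k0 mul0r.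
  have key : X u * (stretch * qx i.1 - sg (i.2 ord0) * tilt_x i.1) +
      Y u * (stretch * qy i.1 - sg (i.2 ord0) * tilt_y i.1) + H u * sg (i.2 ord0)
      <= stretch * h0 u ?= iff ((u == i.1) || (u == nx i.1)).
    set v := _ + H u * _.
    have -> : v = stretch * (X u * qx i.1 + Y u * qy i.1) +
        sg (i.2 ord0) * (H u - (X u * tilt_x i.1 + Y u * tilt_y i.1)).
      by rewrite /v; ring.
    have [le_h eq_h] := lp_support L u i.1; apply/leifP; case: ifPn => ui.
      rewrite ui in eq_h; rewrite (eqP eq_h) tilt_facet //.
      by rewrite subrr mulr0 addr0.
    have {}le_h : X u * qx i.1 + Y u * qy i.1 + 1 <= h0 u.
      by rewrite lezD1 lt_neqAle eq_h ui.
    have sc_gt0 : 0 < stretch := le_lt_trans (normr_ge0 _) (tilt_lt_stretch u u).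
    apply: (@lt_le_trans _ _ (stretch * (X u * qx i.1 + Y u * qy i.1) + stretch)).
      rewrite ltrD2l; apply: le_lt_trans (tilt_lt_stretch u i.1).
      by rewrite (le_trans (ler_norm _)) // normrM /sg normrX normrN1 expr1n mul1r.
    by rewrite -[X in _ + X]mulr1 -mulrDr ler_pM2l.
  by rewrite -!rmorphM -!rmorphD; split; rewrite ?ler_int ?eqr_int; case: key.
rewrite mem_facet_inr ray_inr dotE !crdE !mul0r !add0r (bigD1 j) //= !crdE eqxx.
rewrite big1 ?addr0 => [|k /negPf kj]; last by rewrite !crdE kj mul0r.
rewrite -rmorphM /= sg_mul; apply/leifP; case: eqP => _ //.
by rewrite mulrN1z (lt_trans (ltrN10 R)).
Qed.

Variable t0 : B.

Lemma bundle_cover x : exists i, span_cone (facet i) r x.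
Proof.
exact: (in_facet_cone bundle_unit bundle_support bundle_flip (t0, [ffun=> false])).
Qed.

Lemma lift_in_facet i a b : 0 <= a -> 0 <= b ->
  span_cone (facet i) r (a *: r (inl i.1) + b *: r (inl (nx i.1))).
Proof.
by move=> a_ge0 b_ge0; apply: span_coneD; apply: span_coneZ => //;
  apply: span_cone_gen; rewrite mem_facet_inl eqxx ?orbT.
Qed.

Lemma fibre_in_facet t (e : {ffun 'I_m -> bool}) (y : 'rV[R]_(2 + m)) : crd0 y = 0 -> crd1 y = 0 ->
  (forall j, 0 <= (sg (e j))%:~R * crdf j y) ->
  span_cone (facet (t, e)) r y.
Proof.
move=> y0 y1 yf.
have -> : y = \sum_(j in [set: 'I_m]%SET) ((sg (e j))%:~R * crdf j y) *: r (inr (e j, j)).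
  apply: vecP => [||j].
  - rewrite y0 (big_morph (@crd0 R m) (@crd0D R m) (@crd00 R m)) big1 // => j _.
    by rewrite ray_inr !crdE mulr0.
  - rewrite y1 (big_morph (@crd1 R m) (@crd1D R m) (@crd10 R m)) big1 // => j _.
    by rewrite ray_inr !crdE mulr0.
  - rewrite (big_morph (@crdf R m j) (@crdfD R m j) (@crdf0 R m j)) (bigD1 j) ?finset.in_setT //=.
    rewrite ray_inr !crdE eqxx big1 ?addr0 => [|k /andP[_ /negPf kj]].
      by rewrite mulrAC -rmorphM /= sg_mul eqxx mul1r.
    by rewrite ray_inr !crdE eq_sym kj mulr0.
apply: span_cone_sum => // j _; apply: span_cone_gen.
by rewrite mem_facet_inr.
Qed.

Lemma sg_lt0_mul (a : R) : 0 <= (sg (a < 0))%:~R * a.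
Proof.
case: ltP => a0 /=; last by rewrite mul1r.
by rewrite mulrN1z mulN1r oppr_ge0 ltW.
Qed.

(** Over each base cone the fibre parts of the facet cones are all orthants. *)
Lemma fibre_in_some_facet t (y : 'rV[R]_(2 + m)) : crd0 y = 0 -> crd1 y = 0 ->
  exists e : {ffun 'I_m -> bool}, span_cone (facet (t, e)) r y.
Proof.
move=> y0 y1; exists [ffun k => crdf k y < 0]; apply: fibre_in_facet => // k.
by rewrite ffunE; exact: sg_lt0_mul.
Qed.

Lemma fibre_in_facet_through t b j (y : 'rV[R]_(2 + m)) :
  crd0 y = 0 -> crd1 y = 0 -> crdf j y = 0 ->
  exists2 e : {ffun 'I_m -> bool}, inr (b, j) \in facet (t, e) & span_cone (facet (t, e)) r y.
Proof.
move=> y0 y1 yj; exists [ffun k => if k == j then b else crdf k y < 0].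
  by rewrite mem_facet_inr ffunE eqxx.
apply: fibre_in_facet => // k; rewrite ffunE.
by have [->|_] := eqVneq k j; [rewrite yj mulr0|exact: sg_lt0_mul].
Qed.

Lemma facet_lift i x : span_cone (facet i) r x -> exists a b,
  [/\ 0 <= a, 0 <= b,
    crd0 x = a * (X i.1)%:~R + b * (X (nx i.1))%:~R &
    crd1 x = a * (Y i.1)%:~R + b * (Y (nx i.1))%:~R].
Proof.
move=> [c c_ge0 ->]; exists (c (inl i.1)), (c (inl (nx i.1))).
rewrite (sum_facet bundle_unit).
rewrite big_split_ord /= sum_ord2 /bundle_gen.
have lE (l : 'I_2) : fintype.split (lshift m l) = inl l.
  by rewrite -[lshift _ _]/(unsplit (inl _)) unsplitK.
have rE (l : 'I_m) : fintype.split (rshift 2 l) = inr l.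
  by rewrite -[rshift _ _]/(unsplit (inr _)) unsplitK.
rewrite !lE /= !crdE !ray_inl !crdE.
under eq_bigr do rewrite rE.
split=> //.
  rewrite (big_morph (@crd0 R m) (@crd0D R m) (@crd00 R m)) big1 ?addr0 // => j _.
  by rewrite ray_inr !crdE mulr0.
rewrite (big_morph (@crd1 R m) (@crd1D R m) (@crd10 R m)) big1 ?addr0 // => j _.
by rewrite ray_inr !crdE mulr0.
Qed.

Lemma base_neq0 t : (X t != 0) || (Y t != 0).
Proof.
rewrite -negb_and; apply/negP => /andP[/eqP x0 /eqP y0].
by have := (det_nx t); rewrite x0 y0 mul0r mulr0 subrr => /eqP; rewrite eq_sym oner_eq0.
Qed.

Variable G : set (set 'rV[R]_(2 + m)).
Hypotheses (fanG : fan G) (simpG : simplicial G).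
Hypothesis refG : refines (facet_fan bundle_ray bundle_gen) G.

(** The span of the carrier meets the fibre only in 0, because the facet cones
through the ray contain all fibre vectors. If the carrier were not a ray, its
span would therefore be a graph over the plane, containing the lifts of the two
neighbours of t; the kink at t excludes this. *)
Lemma base_ray_carrier t E x : carrier G (r (inl t)) E -> E x ->
  exists k, x = k *: r (inl t).
Proof.
move=> carE Ex; have cE := carrier_convex simpG carE.
have t_in s e : (t == s) || (t == nx s) -> inl t \in facet (s, e) by rewrite mem_facet_inl.
have EdiffE := sub_diff cE.
have fibre_E y : crd0 y = 0 -> crd1 y = 0 -> lin_diff E y -> E y.
  move=> y0 y1; have [e] := fibre_in_some_facet t y0 y1.
  by apply: (carrier_absorb1 simpG refG) carE; rewrite t_in ?eqxx.
have fibre0 y : crd0 y = 0 -> crd1 y = 0 -> lin_diff E y -> y = 0.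
  move=> y0 y1 Ey; apply: (carrier_pointed simpG carE); apply: fibre_E => //.
  - by rewrite crdE y0 oppr0.
  - by rewrite crdE y1 oppr0.
  - exact: diffN.
have Et : lin_diff E (r (inl t)) by apply: EdiffE; case: carE.
(* The planar determinant of w_t and x. It is 0 just when their planar parts are
   proportional, and then x is on the line of w_t since W meets U in 0. *)
pose d := (X t)%:~R * crd1 x - (Y t)%:~R * crd0 x.
have [d0|d_neq0] := eqVneq d 0.
  have prop a b : a * (X t)%:~R = b * crd0 x -> a * (Y t)%:~R = b * crd1 x ->
      b *: x = a *: r (inl t).
    move=> eX eY; apply/eqP; rewrite -subr_eq0; apply/eqP; apply: fibre0.
    - by rewrite !crdE ray_inl crdE eX subrr.
    - by rewrite !crdE ray_inl crdE eY subrr.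
    - by apply: diffB => //; apply: diffZ => //; exact: EdiffE.
  move/eqP: d0; rewrite subr_eq0 => /eqP d0.
  case/orP: (base_neq0 t) => nz.
    exists (crd0 x / (X t)%:~R); rewrite [_ / _]mulrC -scalerA -(prop _ (X t)%:~R).
    + by rewrite scalerA mulVf ?scale1r // intr_eq0.
    + by rewrite mulrC.
    + by rewrite d0 mulrC.
  exists (crd1 x / (Y t)%:~R); rewrite [_ / _]mulrC -scalerA -(prop _ (Y t)%:~R).
  + by rewrite scalerA mulVf ?scale1r // intr_eq0.
  + by rewrite -d0 mulrC.
  + by rewrite mulrC.
have span_base a b : exists2 g, lin_diff E g & crd0 g = a /\ crd1 g = b.
  exists (((a * crd1 x - b * crd0 x) / d) *: r (inl t) +
          (((X t)%:~R * b - (Y t)%:~R * a) / d) *: x).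
    by apply: diffD => //; apply: diffZ => //; exact: EdiffE.
  rewrite !crdE ray_inl !crdE; split; move: d_neq0; rewrite /d => dn; field; exact: dn.
have lift_E s z : (t == s) || (t == nx s) ->
    (forall e, span_cone (facet (s, e)) r z) -> E z.
  move=> ts zK; have [g Eg [g0 g1]] := span_base (crd0 z) (crd1 z).
  have y0 : crd0 (g - z) = 0 by rewrite !crdE g0 subrr.
  have y1 : crd1 (g - z) = 0 by rewrite !crdE g1 subrr.
  have [e yK] := fibre_in_some_facet s y0 y1.
  apply: (carrier_absorb simpG refG (t_in s e ts) carE (zK e) yK).
  by rewrite addrC subrK.
have Enx : E (r (inl (nx t))).
  apply: (lift_E t) => [|e]; first by rewrite eqxx.
  by apply: span_cone_gen; rewrite mem_facet_inl eqxx orbT.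
have Epv : E (r (inl (pv t))).
  apply: (lift_E (pv t)) => [|e]; first by rewrite pvK eqxx orbT.
  by apply: span_cone_gen; rewrite mem_facet_inl eqxx.
(* The relation v_prev + v_next = c v_t, for both coordinates at once: it is the
   three-term identity of planar determinants. *)
have d1 := det_nx t; have d2 := (det_nx (pv t)); rewrite pvK in d2.
pose c := det (pv t) (nx t).
have rel_base (Z : B -> int) : (forall s u v, Z s * det u v + Z u * det v s + Z v * det s u = 0) ->
    Z (pv t) + Z (nx t) - c * Z t = 0.
  by move=> /(_ (pv t) t (nx t)); rewrite d1 d2 /c => <-; ring.
suff : r (inl (pv t)) + r (inl (nx t)) - c%:~R *: r (inl t) = 0.
  move/(congr1 (@crdf R m ord0)); rewrite !crdE !ray_inl !crdE eqxx => /eqP.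
  rewrite -rmorphM -rmorphD -rmorphB intr_eq0 subr_eq0 => /eqP eqH.
  by have := lp_bend L t; rewrite eqH eqxx.
apply: fibre0.
- rewrite !crdE !ray_inl !crdE -rmorphM -rmorphD -rmorphB rel_base // => s u v.
  by ring.
- rewrite !crdE !ray_inl !crdE -rmorphM -rmorphD -rmorphB rel_base // => s u v.
  by ring.
- by apply: diffB => //; [apply: diffD => //; exact: EdiffE|exact: diffZ].
Qed.

(** Let z be the lift of the planar part of x. Up to a multiple of the ray itself,
x differs from z by a fibre vector y in the remaining fibre directions, and such
vectors occur in facet cones through the ray over any base cone. So z is in the
carrier E; the same argument for - x, over the opposite base cone, gives - z.
Since E is pointed, x has no planar part. *)
Lemma fibre_ray_carrier b j E x : carrier G (r (inr (b, j))) E -> E x ->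
  exists k, x = k *: r (inr (b, j)).
Proof.
move=> carE Ex; have cE := carrier_convex simpG carE.
have EdiffE := sub_diff cE; set e := r (inr (b, j)).
have sgsg : (sg b)%:~R * (sg b)%:~R = 1 :> R by rewrite -rmorphM sg_mul eqxx.
have [e0 e1 ej] : [/\ crd0 e = 0, crd1 e = 0 & crdf j e = (sg b)%:~R].
  by rewrite /e ray_inr !crdE eqxx.
have Ee : lin_diff E e by apply: EdiffE; case: carE.
have fibre_E y : crd0 y = 0 -> crd1 y = 0 -> crdf j y = 0 -> lin_diff E y -> E y.
  move=> y0 y1 yj; have [f bf] := fibre_in_facet_through t0 b y0 y1 yj.
  exact: (carrier_absorb1 simpG refG) carE.
have fibre0 y : crd0 y = 0 -> crd1 y = 0 -> crdf j y = 0 -> lin_diff E y -> y = 0.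
  move=> y0 y1 yj Ey; apply: (carrier_pointed simpG carE); apply: fibre_E => //;
    by [rewrite crdE ?y0 ?y1 ?yj oppr0|exact: diffN].
have lift_E s z y : crd0 y = 0 -> crd1 y = 0 -> crdf j y = 0 ->
    (forall f, span_cone (facet (s, f)) r z) -> lin_diff E (z + y) -> E z.
  move=> y0 y1 yj zK; have [f bf yK] := fibre_in_facet_through s b y0 y1 yj.
  exact: (carrier_absorb simpG refG bf carE).
have [[s f] /facet_lift /= [a [a' [a_ge0 a'_ge0 x0 x1]]]] := bundle_cover x.
pose z := a *: r (inl s) + a' *: r (inl (nx s)).
pose c := (sg b)%:~R * crdf j (x - z).
pose y := x - z - c *: e.
have xzy : x - c *: e = z + y by rewrite /y !addrA (addrC z x) addrK.
have y0 : crd0 y = 0 by rewrite /y /z !crdE e0 !ray_inl !crdE x0; ring.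
have y1 : crd1 y = 0 by rewrite /y /z !crdE e1 !ray_inl !crdE x1; ring.
have yj : crdf j y = 0.
  by rewrite /y crdE crdfN crdfZ ej /c mulrAC sgsg mul1r subrr.
have Exc : lin_diff E (x - c *: e) by apply: diffB; [|exact: EdiffE|exact: diffZ].
have Ez : E z.
  apply: (lift_E s z y) => //; last by rewrite -xzy.
  by move=> g; exact: (@lift_in_facet (s, g)).
have ENz : E (- z).
  apply: (lift_E (opp s) (- z) (- y)); rewrite ?crd0N ?crd1N ?crdfN ?y0 ?y1 ?yj ?oppr0 //.
  - move=> g; have -> : - z = a *: r (inl (opp s)) + a' *: r (inl (nx (opp s))).
      rewrite -lp_opp_next; apply: vecP => [||k]; rewrite /z !crdE !ray_inl !crdE;
        rewrite ?lp_x_opp ?lp_y_opp ?lp_lift_opp ?mulrNz ?mulrN ?opprD //.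
      by case: ifP; rewrite ?mulr0 ?oppr0 ?mulrN.
    exact: (@lift_in_facet (opp s, g)).
  - by rewrite -opprD -xzy; exact: diffN.
have z0 : z = 0 := carrier_pointed simpG carE Ez ENz.
exists c; apply/eqP; rewrite -subr_eq0; apply/eqP; apply: fibre0 => //;
  by rewrite xzy z0 add0r.
Qed.

Theorem bundle_rigid : G = facet_fan bundle_ray bundle_gen.
Proof.
apply: (coarsening_eq bundle_unit fanG simpG refG bundle_cover) => i t E x _.
case: t => [u|[b j]]; [exact: base_ray_carrier|exact: fibre_ray_carrier].
Qed.

End Bundle.

(** * A centrally symmetric polygon with lifts on the moment curve *)

Section MomentPolygon.
Variable p : nat.

Local Notation B := (bool * 'I_p.+2)%type.

(** One half of the rays: (1, k) lifted to k^2 for k <= p, and (0, 1) lifted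
to 0 for the last index p + 1. *)
Definition half_x (k : nat) : int := if (k <= p)%N then 1 else 0.
Definition half_y (k : nat) : int := if (k <= p)%N then k%:Z else 1.
Definition half_lift (k : nat) : int := if (k <= p)%N then (k * k)%:Z else 0.

Definition moment_x (t : B) : int := sg t.1 * half_x t.2.
Definition moment_y (t : B) : int := sg t.1 * half_y t.2.
Definition moment_lift (t : B) : int := sg t.1 * half_lift t.2.

Definition moment_next (t : B) : B :=
  if (t.2 <= p)%N then (t.1, inord t.2.+1) else (~~ t.1, ord0).
Definition moment_prev (t : B) : B :=
  if t.2 == ord0 then (~~ t.1, ord_max) else (t.1, inord t.2.-1).
Definition moment_opp (t : B) : B := (~~ t.1, t.2).

Definition half_det (k i : nat) : int := half_x k * half_y i - half_x i * half_y k.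

(** The sign of the determinant with ray i on the open cone between the rays l
and l + 1. *)
Definition side (l i : nat) : int := if (i <= l)%N then -1 else 1.

(** The support function is the sum over one half of the rays of the absolute
values of the determinants with them; its polygon is a zonogon with one pair of
edges for each pair of opposite rays. On each cone the signs of the determinants
are constant and the function is linear, which gives the vertex. *)
Definition zonogon_x (t : B) : int := sg t.1 * \sum_(i < p.+2) side t.2 i * half_y i.
Definition zonogon_y (t : B) : int := - (sg t.1 * \sum_(i < p.+2) side t.2 i * half_x i).
Definition zonogon_height (t : B) : int := \sum_(i < p.+2) `|half_det t.2 i|.

Lemma sgN b : sg (~~ b) = - sg b.
Proof. by case: b. Qed.

Lemma sgsg b : sg b * sg b = 1.
Proof. by case: b. Qed.

Lemma moment_prevK : cancel moment_prev moment_next.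
Proof.
case=> s k; rewrite /moment_prev /=; case: eqVneq => [->|k0].
  by rewrite /moment_next /= ltnn negbK.
have k_gt0 : (0 < k)%N by rewrite lt0n.
have kp : (k.-1 < p.+2)%N by have := ltn_ord k; lia.
rewrite /moment_next /= inordK //; have -> : (k.-1 <= p)%N by have := ltn_ord k; lia.
by congr (_, _); apply: val_inj; rewrite /= inordK prednK.
Qed.

Lemma moment_x_opp t : moment_x (moment_opp t) = - moment_x t.
Proof. by rewrite /moment_x sgN mulNr. Qed.

Lemma moment_y_opp t : moment_y (moment_opp t) = - moment_y t.
Proof. by rewrite /moment_y sgN mulNr. Qed.

Lemma moment_lift_opp t : moment_lift (moment_opp t) = - moment_lift t.
Proof. by rewrite /moment_lift sgN mulNr. Qed.

Lemma moment_opp_next t : moment_opp (moment_next t) = moment_next (moment_opp t).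
Proof. by rewrite /moment_opp /moment_next /=; case: ifP. Qed.

Lemma half_det_gt0 k i : (k < i)%N -> (i <= p.+1)%N -> 0 < half_det k i.
Proof.
move=> ki ip; rewrite /half_det /half_x /half_y.
have -> : (k <= p)%N by lia.
by case: ifP => ipp; lia.
Qed.

Lemma half_detC k i : half_det i k = - half_det k i.
Proof. by rewrite /half_det; ring. Qed.

Lemma moment_det_next t :
  moment_x t * moment_y (moment_next t) - moment_x (moment_next t) * moment_y t = 1.
Proof.
case: t => s k; rewrite /moment_x /moment_y /moment_next /=; case: ifP => kp /=.
  rewrite inordK; last by lia.
  transitivity (sg s * sg s * half_det k k.+1); first by rewrite /half_det; ring.
  rewrite sgsg mul1r /half_det /half_x /half_y kp; case: ifP => kp'; lia.
rewrite sgN; transitivity (sg s * sg s * (- half_det k 0)); first by rewrite /half_det; ring.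
by rewrite sgsg mul1r /half_det /half_x /half_y kp /=.
Qed.

Lemma moment_bend t : (0 < p)%N -> moment_lift (moment_prev t) + moment_lift (moment_next t) !=
  (moment_x (moment_prev t) * moment_y (moment_next t) -
   moment_x (moment_next t) * moment_y (moment_prev t)) * moment_lift t.
Proof.
move=> p_gt0; case: t => s k; have kp := ltn_ord k.
have sq : sg s * sg s = 1 := sgsg s.
rewrite /moment_x /moment_y /moment_lift /moment_next /moment_prev /=.
case: (altP (k =P ord0)) => [k0|k0]; case: (boolP (k <= p)%N) => [kp1|kp1] /=.
- rewrite inordK; last by lia.
  rewrite sgN k0 /= /half_x /half_y /half_lift ltnn /= p_gt0.
  by case: s {sq}.
- by move: kp1; rewrite k0.
- have {}k0 : (0 < k)%N by rewrite lt0n.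
  rewrite !inordK; try lia.
  have -> : (sg s * half_x k.-1 * (sg s * half_y k.+1) - sg s * half_x k.+1 * (sg s * half_y k.-1)) *
      (sg s * half_lift k) = sg s * (half_det k.-1 k.+1 * half_lift k).
    transitivity (sg s * sg s * (sg s * (half_det k.-1 k.+1 * half_lift k))).
      by rewrite /half_det; ring.
    by rewrite sq mul1r.
  rewrite -mulrDr -subr_eq0 -mulrBr mulf_neq0 //; first by case: (s).
  rewrite /half_det /half_lift /half_x /half_y kp1; have -> : (k.-1 <= p)%N by lia.
  case: ifP => kp2; nia.
- have {}kp1 : k = p.+1 :> nat by lia.
  rewrite inordK ?kp1 //= /half_lift ltnn leqnn leq0n /=.
  rewrite !mulr0 addr0 mulf_neq0 //; first by case: (s).
  nia.
Qed.

Lemma sign_mul_le_norm (d : int) (b : bool) :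
  sg b * d <= `|d| ?= iff (0 <= sg b * d).
Proof.
have -> : `|d| = `|sg b * d| by rewrite normrM /sg normrX normrN1 expr1n mul1r.
split; first exact: ler_norm.
by rewrite eq_sym; apply/eqP/idP => [<-|/ger0_norm].
Qed.

(** The value at u of the linear piece on the cone of t flips the signs of some
determinants, so it is at most the sum of their absolute values. Equality means
that no nonzero determinant has the wrong sign, and a witness to the contrary is
the ray l + 1 or l next to the cone, or an end of the half when u is on the
opposite side. *)
Lemma zonogon_support u t :
  moment_x u * zonogon_x t + moment_y u * zonogon_y t <= zonogon_height u ?= iff (u == t) || (u == moment_next t).
Proof.
case: u t => [s k] [s' l].
have kp := ltn_ord k; have lp := ltn_ord l.
pose c (i : 'I_p.+2) := s (+) s' (+) (i <= l)%N.
have -> : moment_x (s, k) * zonogon_x (s', l) + moment_y (s, k) * zonogon_y (s', l) =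
    \sum_(i < p.+2) sg (c i) * half_det k i.
  rewrite /moment_x /moment_y /zonogon_x /zonogon_y /= mulrN !mulr_sumr -sumrB.
  apply: eq_bigr => i _.
  have -> : sg (c i) = sg s * sg s' * side l i.
    by rewrite /c /side /sg !signr_addb; case: (i <= l)%N; rewrite ?mulr1.
  by rewrite /half_det; ring.
have -> : ((s, k) == (s', l)) || ((s, k) == moment_next (s', l)) =
    [forall i, 0 <= sg (c i) * half_det k i].
  have D0 i : half_det i i = 0 by rewrite /half_det subrr.
  have Dlt i : (i < k)%N -> half_det k i < 0.
    by move=> ik; rewrite half_detC oppr_lt0 half_det_gt0 //; lia.
  have Dgt (i : 'I_p.+2) : (k < i)%N -> 0 < half_det k i.
    by move=> ki; rewrite half_det_gt0 //; have := ltn_ord i; lia.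
  apply/idP/forallP => [ut i|c_ge0].
    have : if s (+) s' then (k == 0 :> nat) && (l == p.+1 :> nat)
        else (k == l :> nat) || (k == l.+1 :> nat).
      move: ut; rewrite /moment_next /= !xpair_eqE => /orP[/andP[/eqP-> /eqP->]|].
        by rewrite addbb eqxx.
      case: ifP => lp'; rewrite xpair_eqE => /andP[/eqP-> /eqP->].
        by rewrite addbb inordK ?eqxx ?orbT //; lia.
      have -> : l = p.+1 :> nat by lia.
      by rewrite addNb addbb eqxx.
    have ip := ltn_ord i; move=> {}ut; rewrite /c.
    have [ik|ki|/val_inj<-] := ltngtP i k; last by rewrite D0 mulr0.
      have /ltW di := Dlt i ik; case: s {c} ut => [] /=; case: s' => [] /= ut ;
      case: (leqP i l) => il; rewrite /sg /= ?expr0 ?expr1 ?mul1r ?mulN1r ?oppr_ge0 //;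
        exfalso; clear -ip kp ik ut il; lia.
    have /ltW di := Dgt i ki; case: s {c} ut => [] /=; case: s' => [] /= ut ;
    case: (leqP i l) => il; rewrite /sg /= ?expr0 ?expr1 ?mul1r ?mulN1r ?oppr_ge0 //;
        exfalso; clear -ip kp ki ut il; lia.
  have lt_side i : sg (c i) * half_det k i < 0 -> False.
    by have := c_ge0 i; case: ltP.
  have [s_eq|s_neq] := eqVneq s s'.
    have cE i : c i = (i <= l)%N by rewrite /c s_eq addbb.
    have [kl|lk|kl] := ltngtP k l.
    - case: (lt_side l); rewrite cE leqnn /sg expr1 mulN1r oppr_lt0.
      exact: Dgt.
    - have [k_eq|k_neq] := eqVneq (k : nat) l.+1.
        apply/orP; right; rewrite /moment_next /=; have -> : (l <= p)%N by lia.
        by rewrite xpair_eqE s_eq eqxx -val_eqE /= inordK ?k_eq //; lia.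
      have l1p : (l.+1 < p.+2)%N by lia.
      case: (lt_side (Ordinal l1p)); rewrite cE /= ltnn /sg expr0 mul1r.
      by apply: Dlt; lia.
    - by apply/orP; left; rewrite xpair_eqE s_eq eqxx -val_eqE /= kl eqxx.
  have cE i : c i = ~~ (i <= l)%N by rewrite /c; case: (s) (s') s_neq => -[].
  have k0 : k = 0 :> nat.
    case: (posnP k) => // k_gt0; case: (lt_side ord0).
    by rewrite cE leq0n /sg expr0 mul1r; exact: Dlt.
  have l_eq : l = p.+1 :> nat.
    apply/eqP; rewrite eqn_leq -ltnS lp /= leqNgt; apply/negP => lp1.
    case: (lt_side ord_max); rewrite cE -ltnNge /= lp1 /sg expr1 mulN1r oppr_lt0.
    by apply: half_det_gt0; rewrite ?k0.
  apply/orP; right; rewrite /moment_next /= l_eq ltnn xpair_eqE -val_eqE /= k0 eqxx andbT.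
  by case: (s) (s') s_neq => -[].
by apply: leif_sum => i _; exact: sign_mul_le_norm.
Qed.

Definition moment_polygon (p_gt0 : (0 < p)%N) : lifted_polygon (bool * 'I_p.+2)%type :=
  LiftedPolygon moment_prevK moment_det_next moment_opp_next
    moment_x_opp moment_y_opp moment_lift_opp (moment_bend^~ p_gt0) zonogon_support.

End MomentPolygon.

Local Close Scope ring_scope.

Theorem theorem2p27 (R : realType) (n N : nat) (hn : 3 <= n) :
  exists F : set (set 'rV[R]_n),
    [/\ fan F /\ complete F,
        unimodular F,
        polytopal F,
        `I_N #<= rays F &
        forall G : set (set 'rV[R]_n),
          fan G -> complete G -> unimodular G -> refines F G -> G = F].
Proof.
case: n hn => [|[|[|m]]] // _; rewrite -[m.+3]/(2 + m.+1)%N.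
pose p := N.+1; pose L := moment_polygon (ltn0Sn N : (0 < p)%N).
have unit := @bundle_unit _ m L.
have supp := @bundle_support R _ m L.
have flip := @bundle_flip _ m L.
pose t0 : bool * 'I_p.+2 := (false, ord0).
pose i0 : (bool * 'I_p.+2) * {ffun 'I_m.+1 -> bool} := (t0, [ffun=> false]).
exists (facet_fan (bundle_ray L) (bundle_gen L)); split.
- split; first exact: (facet_fan_fan unit supp).
  exact: (facet_complete unit supp flip i0).
- exact: (facet_unimodular _ unit i0).
- exact: (facet_polytopal unit supp flip i0).
- apply: (facet_rays unit supp (tau := fun k => inl (false, inord k))) => [k|k l kN lN].
    by exists ((false, inord k), [ffun=> false]); rewrite mem_facet_inl eqxx.
  by move=> [] /(congr1 val); rewrite /= !inordK; lia.
- move=> G fanG _ [_ simpG _ _] refG.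
  exact: (bundle_rigid t0 fanG simpG refG).
Qed.
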